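(* Let $n\ge 1$ be an integer, $0<\alpha<2$, $0<s<1$, $\omega\ge 0$ and $1<r,q<\infty$. Let $F:\mathbb{R}\to\mathbb{R}$ be locally Lipschitz continuous with $F(0)=0$ and $F'\ge c_0$ for some constant $c_0>0$. Suppose that $u\in C^{1,1}_{loc}(\mathbb{R}^n)\cap\mathcal{L}_\alpha(\mathbb{R}^n)$ and $v\in C^{1,1}_{loc}(\mathbb{R}^n)\cap L_{2s}(\mathbb{R}^n)$ are positive solutions of the system $$\begin{cases}\mathcal{F}_\alpha(u(x))+\omega u(x)=v(x)u^r(x), & x\in\mathbb{R}^n,\\ (-\Delta)^s v(x)=u^q(x), & x\in\mathbb{R}^n,\\ u(x)>0,\ v(x)>0, & x\in\mathbb{R}^n,\end{cases}$$ and that $$u(x)\sim\frac{1}{|x|^\gamma},\qquad v(x)\sim\frac{1}{|x|^\tau}\qquad\text{for } |x|\text{ sufficiently large},$$ where $\gamma>0$, $\tau>0$ satisfy $$\alpha<\min\{\gamma(r-1)+\tau,\ r\gamma\}\quad\text{and}\quad 2s<\gamma(q-1).$$ Then $u$ and $v$ are radially symmetric and monotone decreasing about some point in $\mathbb{R}^n$.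
   Context: The fully nonlinear nonlocal operator $\mathcal{F}_\alpha$ is $$\mathcal{F}_\alpha(u(x))=C_{n,\alpha}\,\mathrm{P.V.}\int_{\mathbb{R}^n}\frac{F(u(x)-u(y))}{|x-y|^{n+\alpha}}dy=C_{n,\alpha}\lim_{\epsilon\to0}\int_{\mathbb{R}^n\setminus B_\epsilon(x)}\frac{F(u(x)-u(y))}{|x-y|^{n+\alpha}}dy,$$ with $C_{n,\alpha}=(2-\alpha)\alpha 2^{\alpha-2}\frac{\Gamma(\frac{n+\alpha}{2})}{\pi^{n/2}\Gamma(\frac{4-\alpha}{2})}$; $C_{n,2s}$ is the same expression with $\alpha$ replaced by $2s$. ($F'$ is understood almost everywhere, $F$ being locally Lipschitz.) The fractional Laplacian is $(-\Delta)^s v(x)=C_{n,2s}\,\mathrm{P.V.}\int_{\mathbb{R}^n}\frac{v(x)-v(y)}{|x-y|^{n+2s}}dy$. $$\mathcal{L}_\alpha(\mathbb{R}^n)=\Big\{u:\ F(u)\in L^1_{loc}(\mathbb{R}^n),\ \int_{\mathbb{R}^n}\frac{|F(1+u(x))|}{1+|x|^{n+\alpha}}dx<\infty\Big\},$$ $$L_{2s}(\mathbb{R}^n)=\Big\{u\in L^1_{loc}(\mathbb{R}^n):\ \int_{\mathbb{R}^n}\frac{|u(x)|}{1+|x|^{n+2s}}dx<\infty\Big\}.$$ $C^{1,1}_{loc}(\mathbb{R}^n)$ is the space of $C^1$ functions with locally Lipschitz gradient; solutions are understood pointwise. The notation $f(x)\sim|x|^{-\gamma}$ for $|x|$ sufficiently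 large means that there are constants $0<c\le C$ and $R>0$ with $c|x|^{-\gamma}\le f(x)\le C|x|^{-\gamma}$ for all $|x|\ge R$. ''Radially symmetric and monotone decreasing about $x_0$'' means that the function depends only on $|x-x_0|$ and is a decreasing function of $|x-x_0|$; the point $x_0$ is common to $u$ and $v$. *)

(* Defs.v *)
From HB Require Import structures.
From mathcomp Require Import all_boot all_order all_algebra.
From mathcomp Require Import all_classical all_reals all_analysis.

Set Implicit Arguments.
Unset Strict Implicit.
Unset Printing Implicit Defensive.

Import Order.TTheory GRing.Theory Num.Theory.
Import numFieldNormedType.Exports.

Local Open Scope classical_set_scope.
Local Open Scope ring_scope.

Definition rV_display : measure_display.
Proof. by constructor. Qed.

(* The product (equivalently, Borel) sigma-algebra on R^n, set up as the
   library does for n.-tuple. *)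
Section rV_measurable.
Context {R : realType} {n : nat}.

Let coors : 'I_n -> 'rV[R]_n -> R := fun i x => x ord0 i.

Let rV_set0 : g_sigma_preimage coors set0.
Proof. exact: sigma_algebra0. Qed.

Let rV_setC A : g_sigma_preimage coors A -> g_sigma_preimage coors (~` A).
Proof. exact: sigma_algebraC. Qed.

Let rV_bigcup (F : (set 'rV[R]_n)^nat) :
  (forall i, g_sigma_preimage coors (F i)) ->
  g_sigma_preimage coors (\bigcup_i (F i)).
Proof. exact: sigma_algebra_bigcup. Qed.

HB.instance Definition _ := @isMeasurable.Build rV_display 'rV[R]_n
  (g_sigma_preimage coors) rV_set0 rV_setC rV_bigcup.

Lemma measurable_coord_rV (i : 'I_n) :
  measurable_fun [set: 'rV[R]_n] (fun x : 'rV[R]_n => x ord0 i).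
Proof.
move=> _ Y mY; rewrite setTI; apply: sub_sigma_algebra => /=.
rewrite -bigcup_seq/=; exists i => /=; first by rewrite mem_index_enum.
by exists Y => //; rewrite setTI.
Qed.

End rV_measurable.

Lemma measurable_fun_rV {R : realType} (n : nat) d (T : measurableType d)
    (f : T -> 'rV[R]_n) :
  (forall i, measurable_fun [set: T] (fun t => f t ord0 i)) ->
  measurable_fun [set: T] f.
Proof.
move=> mf.
suff prefS : g_sigma_preimage (fun i t => f t ord0 i) `<=` measurable.
  move=> _ A mA; apply: prefS.
  by rewrite (g_sigma_preimage_comp (fun i (x : 'rV[R]_n) => x ord0 i));
    exists A.
apply: smallest_sub; first exact: sigma_algebra_measurable.
case: n => [|m] in f mf *; first by rewrite big_ord0.
rewrite -bigcup_mkord_ord; apply: bigcup_sub => i Ii.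
by move=> A [B mB <-]; exact: mf.
Qed.

Definition rVcons {R : realType} {n : nat} (p : R * 'rV[R]_n) : 'rV[R]_n.+1 :=
  \row_i if unlift ord0 i is Some j then p.2 ord0 j else p.1.

Section lebesgue_rV_succ.
Context {R : realType} {n : nat}.
Variable nu : {sigma_finite_measure set 'rV[R]_n -> \bar R}.

Lemma rVcons0 (p : R * 'rV[R]_n) : rVcons p ord0 ord0 = p.1.
Proof. by rewrite mxE unlift_none. Qed.

Lemma rVconsS (p : R * 'rV[R]_n) (i : 'I_n) :
  rVcons p ord0 (lift ord0 i) = p.2 ord0 i.
Proof. by rewrite mxE liftK. Qed.

Lemma measurable_rVcons : measurable_fun setT (@rVcons R n).
Proof.
apply: measurable_fun_rV => i; have [j ->|->] := unliftP ord0 i.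
  under eq_fun do rewrite rVconsS.
  exact: (measurableT_comp (measurable_coord_rV j) measurable_snd).
by under eq_fun do rewrite rVcons0; exact: measurable_fst.
Qed.

Definition lebesgue_rV_succ : set 'rV[R]_n.+1 -> \bar R :=
  pushforward (lebesgue_measure \x nu)%E (@rVcons R n).

Let succ0 : lebesgue_rV_succ set0 = 0%E.
Proof. by rewrite /lebesgue_rV_succ /pushforward preimage_set0 measure0. Qed.

Let succ_ge0 A : (0 <= lebesgue_rV_succ A)%E.
Proof. exact: (measure_ge0 (lebesgue_measure \x nu)%E). Qed.

Let succ_sigma_additive : semi_sigma_additive lebesgue_rV_succ.
Proof.
move=> A mA tA mUA; rewrite /lebesgue_rV_succ /pushforward preimage_bigcup.
have mpre B : measurable B -> measurable ((@rVcons R n) @^-1` B).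
  by move=> mB; rewrite -[X in measurable X]setTI; exact: measurable_rVcons.
apply: measure_semi_sigma_additive.
- by move=> k; exact: mpre.
- apply/trivIsetP => /= i j _ _ ij; rewrite -preimage_setI.
  by move/trivIsetP : tA => /(_ _ _ _ _ ij) ->//; rewrite preimage_set0.
- by rewrite -preimage_bigcup; exact: mpre.
Qed.

HB.instance Definition _ := isMeasure.Build _ _ _
  lebesgue_rV_succ succ0 succ_ge0 succ_sigma_additive.

Let rVuncons (x : 'rV[R]_n.+1) : R * 'rV[R]_n :=
  (x ord0 ord0, \row_i x ord0 (lift ord0 i)).

Let rVconsK : cancel (@rVcons R n) rVuncons.
Proof.
move=> [a x]; rewrite /rVuncons rVcons0; congr pair.
by apply/rowP => i; rewrite mxE rVconsS.
Qed.

Let measurable_rVuncons : measurable_fun setT rVuncons.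
Proof.
apply: measurable_fun_pair; first exact: measurable_coord_rV.
apply: measurable_fun_rV => i; under eq_fun do rewrite mxE.
exact: measurable_coord_rV.
Qed.

Let succ_sigma_finite : sigma_finite setT lebesgue_rV_succ.
Proof.
have mproj B : measurable B -> measurable (rVuncons @^-1` B).
  by move=> mB; rewrite -[X in measurable X]setTI; exact: measurable_rVuncons.
have /sigma_finiteP[A [TA ndA Aoo]] :=
  @sigma_finiteT _ _ _ (@lebesgue_measure R : {sigma_finite_measure set _ -> \bar R}).
have /sigma_finiteP[B [TB ndB Boo]] := sigma_finiteT nu.
exists (fun k => rVuncons @^-1` (A k `*` B k)).
  apply/seteqP; split => // x _.
  have [k _ Ak] : (\bigcup_k A k) (rVuncons x).1 by rewrite -TA.
  have [l _ Bl] : (\bigcup_k B k) (rVuncons x).2 by rewrite -TB.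
  exists (maxn k l) => //; split.
    by move: Ak; exact/subsetPset/ndA/leq_maxl.
  by move: Bl; exact/subsetPset/ndB/leq_maxr.
move=> k; have [mA Ak] := Aoo k; have [mB Bk] := Boo k.
split; first by apply: mproj; exact: measurableX.
rewrite /lebesgue_rV_succ /pushforward -comp_preimage.
rewrite (_ : rVuncons \o _ = id); last by apply/funext => p; exact: rVconsK.
by rewrite preimage_id product_measure1E// lte_mul_pinfty// ge0_fin_numE.
Qed.

HB.instance Definition _ := Measure_isSigmaFinite.Build _ _ _
  lebesgue_rV_succ succ_sigma_finite.

End lebesgue_rV_succ.

(* Lebesgue measure on R^n, as an iterated product of the one on R. *)
Fixpoint lebesgue_rV {R : realType} (n : nat) :
    {sigma_finite_measure set 'rV[R]_n -> \bar R} :=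
  if n is m.+1 then lebesgue_rV_succ (lebesgue_rV m)
  else \d_(0 : 'rV[R]_0).

Lemma lebesgue_rV_box (R : realType) (n : nat) (a b : 'I_n -> R) :
  (forall i, a i <= b i) ->
  lebesgue_rV n [set x : 'rV[R]_n | forall i, a i <= x ord0 i <= b i] =
  (\prod_(i < n) (b i - a i))%:E.
Proof.
elim: n a b => [|n IH] a b ab.
  by rewrite big_ord0 /= diracE mem_set // => -[].
rewrite big_ord_recl [LHS]/= /lebesgue_rV_succ /pushforward.
rewrite (_ : _ @^-1` _ = `[a ord0, b ord0]%classic `*`
   [set x : 'rV[R]_n | forall i, a (lift ord0 i) <= x ord0 i <= b (lift ord0 i)]).
  rewrite product_measure1E//=; last first.
    rewrite (_ : mkset _ = \bigcap_(i in [set: 'I_n])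
      ((fun x : 'rV[R]_n => x ord0 i) @^-1`
        `[a (lift ord0 i), b (lift ord0 i)]%classic)); last first.
      apply/seteqP; split => x /= xab i; last by have := xab i I; rewrite /= in_itv.
      by move=> _ /=; rewrite in_itv /= xab.
    apply: fin_bigcap_measurable => [|i _]; first exact: finite_finset.
    by rewrite -[X in measurable X]setTI; exact: measurable_coord_rV.
  rewrite IH// lebesgue_measure_itv/= lte_fin EFinM; congr (_ * _)%E.
  have [//|ba] := ltP (a ord0) (b ord0).
  by rewrite (le_anti (introT andP (conj ba (ab ord0)))) subrr.
apply/seteqP; split => -[t x] /=.
  move=> xab; rewrite in_itv/=; split.
    by have := xab ord0; rewrite rVcons0.
  by move=> i; have := xab (lift ord0 i); rewrite rVconsS.
rewrite in_itv/= => -[tab xab] i; have [j ->|->] := unliftP ord0 i.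
  by rewrite rVconsS.
by rewrite rVcons0.
Qed.

Definition locally_lipschitz (R : realType) (V W : normedModType R) (f : V -> W) :=
  forall x : V, exists2 A, nbhs x A & [lipschitz f y | y in A].

Section function_spaces.
Context {R : realType} {n : nat}.
Implicit Types (x y : 'rV[R]_n) (u : 'rV[R]_n -> R) (F : R -> R).

(* The library's norm on row vectors is the sup norm. *)
Definition enorm x : R := Num.sqrt (\sum_(i < n) x ord0 i ^+ 2).

Definition eball x (e : R) : set 'rV[R]_n := [set y | enorm (y - x) < e].

Definition grad u x : 'rV[R]_n := \row_i 'D_(delta_mx ord0 i) u x.

Definition C11loc : set ('rV[R]_n -> R) :=
  [set u | [/\ forall x, differentiable u x, continuous (grad u)
             & locally_lipschitz (grad u)]].

Definition L1loc : set ('rV[R]_n -> R) :=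
  [set u | forall K, compact K -> (lebesgue_rV n).-integrable K (EFin \o u)].

Definition Lalpha F (alpha : R) : set ('rV[R]_n -> R) :=
  [set u | L1loc (F \o u) /\
    (\int[lebesgue_rV n]_x
       (`|F (1 + u x)| / (1 + enorm x `^ (n%:R + alpha)))%:E < +oo)%E].

Definition L2s (s : R) : set ('rV[R]_n -> R) :=
  [set u | L1loc u /\
    (\int[lebesgue_rV n]_x
       (`|u x| / (1 + enorm x `^ (n%:R + 2 * s)))%:E < +oo)%E].

End function_spaces.

Section nonlocal_operators.
Context {R : realType}.

Definition Gamma (z : R) : R :=
  \int[lebesgue_measure]_(t in `]0, +oo[) (t `^ (z - 1) * expR (- t)).

Definition Cnalpha (n : nat) (alpha : R) : R :=
  (2 - alpha) * alpha * 2 `^ (alpha - 2) *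
  (Gamma ((n%:R + alpha) / 2) / (pi `^ (n%:R / 2) * Gamma ((4 - alpha) / 2))).

Context {n : nat}.
Implicit Types (x y : 'rV[R]_n) (u : 'rV[R]_n -> R) (F : R -> R).

Definition Fkernel F (alpha : R) u x y : R :=
  F (u x - u y) / enorm (x - y) `^ (n%:R + alpha).

Definition Ftruncated F (alpha : R) u x (e : R) : R :=
  \int[lebesgue_rV n]_(y in ~` eball x e) Fkernel F alpha u x y.

Definition Falpha F (alpha : R) u x : R :=
  Cnalpha n alpha * lim (Ftruncated F alpha u x e @[e --> 0^'+]).

(* [lim] and the integral are total, so a pointwise equation involving [Falpha]
   is meaningful only together with the existence of the principal value. *)
Definition Falpha_defined F (alpha : R) u x : Prop :=
  (forall e, 0 < e -> (lebesgue_rV n).-integrable (~` eball x e)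
                        (EFin \o Fkernel F alpha u x)) /\
  cvg (Ftruncated F alpha u x e @[e --> 0^'+]).

Definition frac_laplacian (s : R) u x : R := Falpha id (2 * s) u x.

Definition frac_laplacian_defined (s : R) u x : Prop :=
  Falpha_defined id (2 * s) u x.

Definition positive_solution F (alpha s omega r q : R)
    (u v : 'rV[R]_n -> R) : Prop :=
  forall x,
    [/\ Falpha_defined F alpha u x /\
        Falpha F alpha u x + omega * u x = v x * u x `^ r,
        frac_laplacian_defined s v x /\
        frac_laplacian s v x = u x `^ q,
        0 < u x & 0 < v x].

Definition decays_like u (gamma : R) : Prop :=
  exists c C rho : R, [/\ 0 < c, c <= C, 0 < rho &
    forall x, rho <= enorm x ->
      c * enorm x `^ (- gamma) <= u x <= C * enorm x `^ (- gamma)].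

Definition radially_decreasing u (x0 : 'rV[R]_n) : Prop :=
  exists2 phi : R -> R, (forall x, u x = phi (enorm (x - x0)))
    & forall t1 t2, 0 <= t1 -> t1 < t2 -> phi t2 < phi t1.

End nonlocal_operators.

(* Main.v *)
Require Import Defs.
From mathcomp Require Import all_boot all_order all_algebra.
From mathcomp Require Import all_classical all_reals all_analysis.
From mathcomp Require Import measurable_realfun lra.

Set Implicit Arguments.
Unset Strict Implicit.
Unset Printing Implicit Defensive.

Import Order.TTheory GRing.Theory Num.Theory.
Import numFieldNormedType.Exports.

Local Open Scope classical_set_scope.
Local Open Scope ring_scope.

(** Moving planes. For a plane with unit normal [e], let [U], [V] be the
    differences between the reflected functions and [u], [v]. Reflection
    preserves Lebesgue measure, so the principal value of the operator at the
    mirror image of [x] minus the one at [x] is, up to a vanishing error, half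
    the integral of a kernel symmetrized under the reflection; the lower bound on
    [F'] makes this kernel nonpositive where [U] has a nonpositive minimum, whence
    a difference of at most [C d^(-alpha) U(x)], [d] being the distance from [x]
    to the plane. Far out, by the decay hypotheses, and close to the plane, this
    beats the coefficients of the system: at its minimum [-U] is at most half the
    negative part of [V], and conversely, so neither minimum can be negative.
    Hence planes can be moved from infinity until [U] and [V] vanish identically.
    For every direction that final plane passes through a maximum point of [u],
    which gives the radial symmetry. *)

(** The weight [d^(-alpha)] comes from a single cube beyond the plane: its volume is of order [d^n]
    and the kernel there is at least [(4 d)^(-(n + alpha))]. Close to the plane this weight exceeds
    any bounded coefficient. Far out [d] is at most [2 |x|], so it is at least a multiple of
    [|x|^(-alpha)], while [v u^(r-1)], [u^r] and [u^(q-1)] decay at the rates [gamma (r-1) + tau],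
    [r gamma] and [gamma (q-1)]; the conditions on the exponents say that these rates exceed the
    order of the corresponding operator. What remains is a bounded region at positive distance from
    the plane, where strict positivity survives a small move of the plane by compactness. The bound
    on [F'] holds only almost everywhere, so it is first turned into [c0 (b - a) <= F b - F a]. The
    maximum principles are stated for such an [F] and are applied to [v] with the identity as [F].
    [U] and [V] vanish for the same plane, and all final planes contain one chosen maximum point of
    [u]; this gives both functions the same centre. *)

(** * From a bound on [F'] almost everywhere to increments of [F] *)

(** Continuous induction: the supremum of the points [t] with [h a <= h t] inherits the inequality
    from points on its left, and below [b] the local condition on its right would push it
    further. *)
Lemma le_of_locally_nondecreasing (R : realType) (h : R -> R) (a b : R) :
  a <= b ->
  (forall t, a <= t <= b -> exists2 d, 0 < d & forall y, a <= y <= b ->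
    `|y - t| < d -> (t <= y -> h t <= h y) /\ (y <= t -> h y <= h t)) ->
  h a <= h b.
Proof.
move=> ab loc; pose S := [set t | a <= t <= b /\ h a <= h t].
have Sa : S a by split; rewrite ?lexx.
have Sub : has_ubound S by exists b => t [/andP[]].
have hS : has_sup S by split; [exists a|].
have aS : a <= sup S by exact: ub_le_sup.
have Sb : sup S <= b by apply: ge_sup; [exists a|move=> t [/andP[]]].
have [d d0 Hd] := loc (sup S) (introT andP (conj aS Sb)).
have [t [/andP[at_ tb] hat] tS] := sup_adherent d0 hS.
have tle : t <= sup S by apply: ub_le_sup => //; split => //; rewrite at_.
have hS1 : h a <= h (sup S).
  apply: le_trans hat _; apply: (Hd t _ _).2 => //; first by rewrite at_.
  by rewrite ler0_norm ?subr_le0//; lra.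
have [bS|Sltb] := leP b (sup S).
  by have -> : b = sup S by apply/eqP; rewrite eq_le bS.
pose y := Num.min b (sup S + d / 2).
have Sy : sup S < y by rewrite lt_min Sltb /=; lra.
have yb : y <= b by rewrite ge_min lexx.
have yd : y <= sup S + d / 2 by rewrite ge_min lexx orbT.
have : y <= sup S.
  apply: ub_le_sup => //; split; first by apply/andP; split => //; lra.
  apply: le_trans hS1 _; apply: (Hd y _ _).1; [lra| |exact: ltW].
  by rewrite ger0_norm ?subr_ge0 ?ltW//; lra.
by rewrite leNgt Sy.
Qed.

Section lipschitz_derivative_bound.
Context {R : realType}.
Local Notation mu := (@lebesgue_measure R).
Implicit Types (F : R -> R) (a b L e : R).

Lemma derivable_slope_ge F (t c0 : R) e : derivable F t 1 ->
  c0 <= (F^`())%classic t -> 0 < e ->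
  exists2 d, 0 < d & forall y, `|y - t| < d ->
    (t <= y -> (c0 - e) * (y - t) <= F y - F t) /\
    (y <= t -> F y - F t <= (c0 - e) * (y - t)).
Proof.
move=> dF cF e0.
have := dF; rewrite /derivable derive1E in cF *.
move=> /cvgrPdist_lt /(_ e e0); rewrite -/('D_1 F t) => nF.
have [d /= d0 Hd] := nF; exists d => // y ytd.
have [->|yt] := eqVneq y t.
  by rewrite !subrr mulr0 lexx.
have yt0 : y - t != 0 by rewrite subr_eq0.
have := Hd (y - t); rewrite /ball /= sub0r normrN => /(_ ytd yt0).
rewrite (_ : (y - t)%:A = y - t) ?subrK => [H|]; last exact: mulr1.
have {}H : c0 - e <= (y - t)^-1 * (F y - F t).
  move: H; rewrite ltr_norml => /andP[_]; rewrite /GRing.scale /=.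
  move: cF; rewrite /derive; lra.
split => yt'.
  have p : 0 < y - t by rewrite lt_def yt0 subr_ge0.
  by rewrite mulrC -ler_pdivlMl.
have p : y - t < 0 by rewrite lt_def eq_sym yt0/= subr_le0.
rewrite mulrC -ler_ndivlMl//.
Qed.

(* The Lebesgue measure of an open set [V] containing the exceptional null set
   supplies the slope that compensates the Lipschitz constant there. *)
Lemma lipschitz_derivative_ge F a b (c0 : R) L : a <= b -> 0 <= L ->
  (forall x y, a <= x <= b -> a <= y <= b -> `|F x - F y| <= L * `|x - y|) ->
  {ae mu, forall t : R, derivable F t 1 /\ c0 <= (F^`())%classic t} ->
  c0 * (b - a) <= F b - F a.
Proof.
move=> ab L0 lipF [N [mN N0 subN]].
have main e : 0 < e -> c0 * (b - a) <= F b - F a + e * (b - a + (L + `|c0|)).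
  move=> e0.
  have Nfin : (mu N < +oo)%E by rewrite N0 ltry.
  have [V [oV NV VN]] := lebesgue_regularity_outer mN Nfin e0.
  have mV : measurable V by exact: open_measurable.
  have muV : (mu V <= e%:E)%E.
    have -> : mu V = (mu N + mu (V `\` N))%E.
      rewrite -measureU ?setDUK//; first exact: measurableD.
      by rewrite setDE setICA setICr setI0.
    by rewrite N0 add0e ltW.
  have mi x y : measurable (V `&` `]x, y]%classic) by exact: measurableI.
  have fini x y : mu (V `&` `]x, y]%classic) \is a fin_num.
    rewrite ge0_fin_numE//; apply: le_lt_trans (ltry e).
    apply: le_trans muV; apply: le_measure; last exact: subIsetl.
      by apply: mem_set; exact: mi.
    by apply: mem_set; exact: mV.
  pose m t := fine (mu (V `&` `]a, t]%classic)).
  have mD x y : a <= x -> x <= y ->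
      m y = m x + fine (mu (V `&` `]x, y]%classic)).
    move=> ax xy; rewrite /m -fineD// -measureU; last 3 first.
    - exact: mi.
    - exact: mi.
    - apply/seteqP; split => // z [[_ /=]] + [_ /=]; rewrite !in_itv/=; lra.
congr (fine (mu _)); rewrite -setIUr; congr (_ `&` _).
    apply/seteqP; split => z /=; rewrite !in_itv/=.
      by case: (leP z x); [left|right]; lra.
    by move=> [|]; lra.
  (* Off [N] the slope of [F] near [t] is at least [c0 - e], and the term [e * t] makes up the loss.
     Near a point of the open set [V] the function [m] grows with slope 1, so its coefficient pays
     for a slope of [F] as low as [- L] and for [- c0]. Over the whole interval both corrections
     cost only a multiple of [e]. *)
  pose h t := F t - c0 * t + e * t + (L + `|c0|) * m t.
  have Lc0 : 0 <= L + `|c0| by rewrite addr_ge0.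
  have : h a <= h b.
    apply: le_of_locally_nondecreasing => // t /andP[at_ tb].
    have [Nt|nNt] := pselect (N t).
      have /= /nbhs_ballP[d /= d0 Hd] : nbhs t V.
        by apply: open_nbhs_nbhs; split => //; exact: NV.
      have slope x y : a <= x -> x <= y -> y <= b -> `|x - t| < d ->
          `|y - t| < d -> h x <= h y.
        move=> ax xy yb xd yd.
        have E : fine (mu (V `&` `]x, y]%classic)) = y - x.
          rewrite (_ : V `&` _ = `]x, y]%classic); last first.
            apply: setIidr => z /=; rewrite in_itv/= => /andP[xz zy].
            apply: Hd; rewrite /ball/= distrC.
            move: xd yd; rewrite !ltr_norml; lra.
          rewrite lebesgue_measure_itv/= lte_fin.
          by case: ltP => //=; lra.
        rewrite /h (mD x y)// E mulrDr.
        have : F x - F y <= L * (y - x).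
          apply: le_trans (ler_norm _) _; apply: le_trans (lipF _ _ _ _) _.
          + by rewrite ax/=; lra.
          + by rewrite yb andbT; lra.
          by rewrite distrC ger0_norm// subr_ge0.
        have : c0 * (y - x) <= `|c0| * (y - x).
          by rewrite ler_wpM2r ?subr_ge0// ler_norm.
        have : 0 <= e * (y - x) by apply: mulr_ge0; lra.
        by lra.
      exists d => // y /andP[ay yb] yd; split => ty; apply: slope => //;
        by rewrite subrr normr0.
    have [dF cF] : derivable F t 1 /\ c0 <= (F^`())%classic t.
      by apply: contrapT => H; apply: nNt; apply: subN.
    have [d d0 Hd] := derivable_slope_ge dF cF e0.
    exists d => // y /andP[ay yb] yd; have [H1 H2] := Hd y yd.
    split => ty.
      rewrite /h (mD t y)//; have := H1 ty.
      have : 0 <= (L + `|c0|) * fine (mu (V `&` `]t, y]%classic)).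
        by rewrite mulr_ge0// fine_ge0.
      by rewrite mulrDr; lra.
    rewrite /h (mD y t)//; have := H2 ty.
    have : 0 <= (L + `|c0|) * fine (mu (V `&` `]y, t]%classic)).
      by rewrite mulr_ge0// fine_ge0.
    by rewrite mulrDr; lra.
  have ma : m a = 0 by rewrite /m set_itvoc0 setI0 measure0.
  have mb : m b <= e.
    rewrite -lee_fin fineK//; apply: le_trans muV.
    apply: le_measure; last exact: subIsetl.
      by apply: mem_set; exact: mi.
    by apply: mem_set; exact: mV.
  have : (L + `|c0|) * m b <= (L + `|c0|) * e by rewrite ler_wpM2l.
  by rewrite /h ma mulr0; lra.
apply/ler_addgt0Pr => e e0.
have K0 : 0 < b - a + (L + `|c0|) + 1.
  by have := normr_ge0 c0; lra.
apply: le_trans (main (e / (b - a + (L + `|c0|) + 1)) _) _.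
  by rewrite divr_gt0.
rewrite lerD2l mulrAC ler_pdivrMr// ler_wpM2l ?ltW//; lra.
Qed.

(** Lipschitz constants are available only locally, so the estimate is obtained near each point and
    [le_of_locally_nondecreasing], applied to [F t - c0 * t], glues the pieces. *)
Lemma locally_lipschitz_derivative_ge F (c0 : R) : locally_lipschitz F ->
  {ae mu, forall t : R, derivable F t 1 /\ c0 <= (F^`())%classic t} ->
  forall a b, a <= b -> c0 * (b - a) <= F b - F a.
Proof.
move=> lF aeF a b ab.
suff : F a - c0 * a <= F b - c0 * b by rewrite mulrBr; lra.
apply: (@le_of_locally_nondecreasing _ (fun t => F t - c0 * t)) => // t _.
have [A /nbhs_ballP[d /= d0 dA] [M [_ HM]]] := lF t.
(* The Lipschitz notation is a filter statement at infinity: every constant strictly above [M]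
   works, and this one is also nonnegative. *)
have lipA x y : A x -> A y ->
    `|F x - F y| <= (Num.max 0 M + 1) * `|x - y|.
  move=> Ax Ay; apply: (HM _ _ (x, y)) => //=.
  by rewrite (le_lt_trans (_ : M <= Num.max 0 M)) ?ltrDl// le_max lexx orbT.
have M0 : 0 <= Num.max 0 M + 1 by rewrite addr_ge0// le_max lexx.
have inA z x y : x <= z <= y -> `|x - t| < d -> `|y - t| < d -> A z.
  move=> /andP[xz zy] xd yd; apply: dA; rewrite /ball/= distrC.
  by move: xd yd; rewrite !ltr_norml; lra.
have incr x y : x <= y -> `|x - t| < d -> `|y - t| < d ->
    F x - c0 * x <= F y - c0 * y.
  move=> xy xd yd.
  suff : c0 * (y - x) <= F y - F x by rewrite mulrBr; lra.
  apply: (@lipschitz_derivative_ge _ _ _ _ _ xy M0) => // z w zI wI.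
  by apply: lipA; [exact: (inA z x y)|exact: (inA w x y)].
exists d => // y _ yd; split => ty; apply: incr => //; by rewrite subrr normr0.
Qed.

End lipschitz_derivative_bound.

(** * Positivity of the normalizing constant *)

Section Gamma_positive.
Context {R : realType}.
Local Notation mu := (@lebesgue_measure R).

Lemma continuous_powR_gt0 (p a : R) : 0 < a -> {for a, continuous (@powR R ^~ p)}.
Proof.
move=> a0; apply: differentiable_continuous; apply/derivable1_diffP.
by apply: derivable_powR; rewrite in_itv/= a0.
Qed.

Lemma integral_powR (p a b : R) : p != 0 -> 0 < a -> a < b ->
  (\int[mu]_(t in `[a, b]) (t `^ (p - 1))%:E = (p^-1 * (b `^ p - a `^ p))%:E)%E.
Proof.
move=> p0 a0 ab.
have pos t : a <= t -> 0 < t by exact: lt_le_trans.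
rewrite (@continuous_FTC2 _ _ (fun t => p^-1 * t `^ p)) //.
- by rewrite -EFinB -mulrBr.
- apply: continuous_in_subspaceT => t; rewrite inE/= in_itv/= => /andP[at_ _].
  by apply: continuous_powR_gt0; exact: pos.
- have cF t : 0 < t -> {for t, continuous (fun t => p^-1 * t `^ p)}.
    by move=> t0; apply: continuousM; [exact: cst_continuous|exact: continuous_powR_gt0].
  split.
  + move=> t; rewrite in_itv/= => /andP[at_ _].
    apply: derivableM; first exact: derivable_cst.
    by apply: derivable_powR; rewrite in_itv/= andbT pos// ltW.
  + by apply: cvg_at_right_filter; exact: cF.
  + by apply: cvg_at_left_filter; apply: cF; rewrite pos// ltW.
- move=> t; rewrite in_itv/= => /andP[at_ _].
  have t0 : 0 < t by rewrite pos// ltW.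
  rewrite derive1E deriveM//; last 1 first.
    by apply: derivable_powR; rewrite in_itv/= andbT.
  rewrite derive_cst scaler0 addr0.
  rewrite -derive1E powR_derive1 ?in_itv/= ?andbT//.
  by rewrite /GRing.scale/= mulrA mulVf// mul1r.
Qed.

Definition Gamma_integrand (z t : R) := t `^ (z - 1) * expR (- t).

Lemma measurable_Gamma_integrand z (D : set R) :
  measurable_fun D (EFin \o Gamma_integrand z).
Proof.
apply: measurable_funTS; apply/measurable_EFinP.
apply: measurable_funM; first exact: measurable_powR.
by apply: measurableT_comp => //; apply: measurableT_comp => //.
Qed.

Lemma Gamma_integrand_ge0 z t : 0 <= Gamma_integrand z t.
Proof. by rewrite mulr_ge0 ?powR_ge0 ?expR_ge0. Qed.

Lemma Gamma_integrand_le_near0 z t : 2^-1 < z -> 0 < t -> t <= 1 ->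
  Gamma_integrand z t <= t `^ (2^-1 - 1).
Proof.
move=> z2 t0 t1; rewrite /Gamma_integrand.
rewrite -[leRHS]mulr1 ler_pM ?powR_ge0 ?expR_ge0//; last first.
  by rewrite -expR0 ler_expR; lra.
rewrite /powR gt_eqF// ler_expR.
have : ln t <= 0 by rewrite ln_le0.
by move=> h; rewrite ler_wnM2r//; lra.
Qed.

(** The inequality [ln y <= y] at [y = t / (z + 1)] bounds [t^(z+1) * expR (- t)] by
    [(z+1)^(z+1)]. *)
Lemma Gamma_integrand_le_pinfty z t : 0 < z + 1 -> 1 <= t ->
  Gamma_integrand z t <= expR ((z + 1) * ln (z + 1)) * t `^ (- 1 - 1).
Proof.
move=> b0 t1; have t0 : 0 < t by lra.
rewrite /Gamma_integrand /powR gt_eqF// -!expRD ler_expR.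
have : ln (t / (z + 1)) <= t / (z + 1) by rewrite ltW// ln_sublinear// divr_gt0.
rewrite lnM ?posrE ?invr_gt0// lnV ?posrE//.
rewrite -(ler_pM2l b0) mulrBr [X in _ <= X]mulrC divfK ?gt_eqF//.
lra.
Qed.

(** Finiteness matters because [Gamma] is the [fine] part of an integral and would be 0 if the
    integral were infinite. The threshold 1/2 lies below both arguments of [Gamma] in [Cnalpha] and
    makes [t^(-1/2)] a majorant near 0. *)
Lemma integral_Gamma_bounded z : 2^-1 < z ->
  exists M : R, (\int[mu]_(t in `]0%R, +oo[) (Gamma_integrand z t)%:E <= M%:E)%E.
Proof.
move=> z2; pose K := expR ((z + 1) * ln (z + 1)).
(* [2] is the integral of [t^(-1/2)] over (0, 1], and [K] that of [K * t^(-2)] over [1, +oo). *)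
exists (2 + K).
(* Bounded intervals away from 0, on which the fundamental theorem of calculus applies; [k.+2] keeps
   the splitting point 1 strictly inside. *)
pose I (k : nat) := `[(k.+2%:R^-1 : R), k.+2%:R]%classic.
have E : `]0%R, +oo[%classic = \bigcup_k I k.
  apply/seteqP; split => t /=; rewrite in_itv/= andbT.
    move=> t0; pose k := (Num.bound t + Num.bound t^-1)%N.
    exists k => //=; rewrite /I /= in_itv/=.
    have ht : t < (Num.bound t)%:R.
      by apply: archi_boundP; exact: ltW.
    have hi : t^-1 < (Num.bound t^-1)%:R.
      by apply: archi_boundP; rewrite ltW// invr_gt0.
    apply/andP; split.
      rewrite -[t]invrK lef_pV2 ?posrE ?invr_gt0//.
      by rewrite (le_trans (ltW hi))// ler_nat -addn2 -addnA addnCA leq_addr.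
    by rewrite (le_trans (ltW ht))// ler_nat -addn2 -addnA leq_addr.
  case=> k _; rewrite /I /= in_itv/= => /andP[+ _]; apply: lt_le_trans.
  by rewrite invr_gt0.
have k2 (k : nat) : 0 < k.+2%:R^-1 :> R by rewrite invr_gt0.
have k21 (k : nat) : k.+2%:R^-1 < 1 :> R by rewrite invf_lt1 // ltr1n.
have cvgI : (\int[mu]_(t in I k) (Gamma_integrand z t)%:E @[k --> \oo] -->
    \int[mu]_(t in \bigcup_k I k) (Gamma_integrand z t)%:E)%E.
  apply: ge0_nondecreasing_set_cvg_integral.
  - move=> i j ij; apply/subsetPset => t; rewrite /I/= !in_itv/= => /andP[a b].
    apply/andP; split.
      by rewrite (le_trans _ a)// lef_pV2 ?posrE// ler_nat.
    by rewrite (le_trans b)// ler_nat.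
  - by move=> i; exact: measurable_itv.
  - by move=> i; exact: measurable_Gamma_integrand.
  - by move=> i t _; rewrite lee_fin Gamma_integrand_ge0.
rewrite E; apply: (cvge_to_le cvgI); near=> k.
have -> : I k = `[k.+2%:R^-1, 1]%classic `|` `]1, k.+2%:R]%classic.
  by rewrite /I (itv_bndbnd_setU (x := BRight 1)) ?bnd_simp ?ltW// ltr1n.
rewrite ge0_integral_setU//; last 3 first.
- exact: measurable_Gamma_integrand.
- by move=> t _; rewrite lee_fin Gamma_integrand_ge0.
- apply/disj_setPS => t /= []; rewrite !in_itv/=; lra.
rewrite EFinD; apply: leeD.
  apply: (@le_trans _ _ (\int[mu]_(t in `[k.+2%:R^-1%R, 1%R]) (t `^ (2^-1 - 1))%:E)%E).
    apply: ge0_le_integral => //.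
    - by move=> t _; rewrite lee_fin Gamma_integrand_ge0.
    - exact: measurable_Gamma_integrand.
    - by apply: measurable_funTS; apply/measurable_EFinP; exact: measurable_powR.
    - move=> t /=; rewrite in_itv/= => /andP[a b]; rewrite lee_fin.
      by apply: Gamma_integrand_le_near0 => //; exact: lt_le_trans a.
  rewrite integral_powR// ?invr_neq0// lee_fin powR1 invrK.
  by have := powR_ge0 (k.+2%:R^-1 : R) 2^-1; lra.
apply: (@le_trans _ _ (\int[mu]_(t in `[1%R, k.+2%:R]) (Gamma_integrand z t)%:E)%E).
  apply: ge0_subset_integral => //.
  - exact: measurable_Gamma_integrand.
  - by move=> t _; rewrite lee_fin Gamma_integrand_ge0.
  - by move=> t /=; rewrite !in_itv/=; lra.
apply: (@le_trans _ _ (\int[mu]_(t in `[1%R, k.+2%:R]) (K%:E * (t `^ (- 1 - 1))%:E))%E).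
  apply: ge0_le_integral => //.
  - by move=> t _; rewrite lee_fin Gamma_integrand_ge0.
  - exact: measurable_Gamma_integrand.
  - apply: measurable_funTS; under eq_fun do rewrite -EFinM; apply/measurable_EFinP.
    by apply: measurable_funM => //; exact: measurable_powR.
  - move=> t /=; rewrite in_itv/= => /andP[a b]; rewrite -EFinM lee_fin.
    by apply: Gamma_integrand_le_pinfty => //; lra.
rewrite ge0_integralZl//; last 3 first.
- by apply: measurable_funTS; apply/measurable_EFinP; exact: measurable_powR.
- by move=> t _; rewrite lee_fin powR_ge0.
- by rewrite lee_fin expR_ge0.
rewrite integral_powR// ?ltr1n// -EFinM lee_fin powR1.
rewrite ler_piMr ?expR_ge0//.
have := powR_ge0 (k.+2%:R : R) (-1).
have -> : (- 1)^-1 = -1 :> R by rewrite invrN invr1.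
lra.
Unshelve. all: by end_near. Qed.

Lemma Gamma_gt0 (z : R) : 2^-1 < z -> 0 < Gamma z.
Proof.
move=> z2; have [M HM] := integral_Gamma_bounded z2.
rewrite /Gamma /Rintegral fine_gt0//; apply/andP; split; last first.
  exact: le_lt_trans HM (ltry _).
(* A lower bound of the integrand on [1, 2]: the power is monotone, so it is smallest at an
   endpoint. *)
pose c := Num.min 1 (2 `^ (z - 1)) * expR (- 2).
have c0 : 0 < c by rewrite mulr_gt0 ?expR_gt0// lt_min ltr01 powR_gt0.
apply: (@lt_le_trans _ _ (\int[mu]_(t in `[1%R, 2%R]) c%:E)%E).
  rewrite integral_cst//= lebesgue_measure_itv/= lte_fin ltr1n/= -EFinB -EFinM lte_fin.
  by rewrite mulr_gt0//; lra.
apply: (@le_trans _ _ (\int[mu]_(t in `[1%R, 2%R]) (Gamma_integrand z t)%:E)%E).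
  apply: ge0_le_integral => //.
  - by move=> t _; rewrite lee_fin ltW.
  - exact: measurable_Gamma_integrand.
  - move=> t /=; rewrite in_itv/= => /andP[a b]; rewrite lee_fin.
    apply: ler_pM; rewrite ?expR_ge0 ?ler_expR ?lerN2//.
    rewrite ge_min.
    have [z1|z1] := leP 0 (z - 1).
      have := ge0_ler_powR z1; move=> /(_ 1 t); rewrite !nnegrE powR1 => ->//; lra.
    apply/orP; right; rewrite /powR !gt_eqF//; last by lra.
    rewrite ler_expR; apply: ler_wnM2l; first exact: ltW.
    by rewrite ler_ln ?posrE//; lra.
apply: ge0_subset_integral => //.
- exact: measurable_Gamma_integrand.
- by move=> t _; rewrite lee_fin Gamma_integrand_ge0.
- by move=> t /=; rewrite !in_itv/=; lra.
Qed.

Lemma Cnalpha_gt0 (n : nat) (alpha : R) :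
  (1 <= n)%N -> 0 < alpha -> alpha < 2 -> 0 < Cnalpha n alpha.
Proof.
move=> n1 a0 a2; have n1' : 1 <= n%:R :> R by rewrite ler1n.
rewrite /Cnalpha; repeat apply: mulr_gt0; rewrite ?invr_gt0 ?powR_gt0//.
- lra.
- by apply: Gamma_gt0; lra.
- by apply: mulr_gt0; [exact/powR_gt0/pi_gt0|apply: Gamma_gt0; lra].
Qed.

End Gamma_positive.

(** * Reflection invariance of Lebesgue measure *)

Section lebesgue_rV_invariance.
Context {R : realType}.
Local Notation mu := (@lebesgue_measure R).

Lemma lebesgue_measure_translation (a : R) (A : set R) : measurable A ->
  mu ((fun x => x + a) @^-1` A) = mu A.
Proof.
move=> mA; pose f (x : measurableTypeR R) : measurableTypeR R := x + a.
have mf : measurable_fun setT f by exact: measurable_funD.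
apply/esym; apply: (@lebesgue_measure_unique R
  (measure_function_pushforward__canonical__measure_function_Measure mu mf)) => //.
move=> _ [[b c] _ <-] /=; rewrite /pushforward.
rewrite (_ : f @^-1` _ = `]b - a, c - a]%classic); last first.
  by apply/seteqP; split => x /=; rewrite !in_itv/= /f; lra.
rewrite !lebesgue_measure_itv/= !lte_fin ltrD2r.
by case: ifP => // _; rewrite -!EFinB opprB addrA subrK.
Qed.

Lemma measurable_funD_rV d (T : measurableType d) n (f g : T -> 'rV[R]_n) :
  measurable_fun setT f -> measurable_fun setT g ->
  measurable_fun setT (fun x => f x + g x).
Proof.
move=> mf mg; apply: measurable_fun_rV => i; under eq_fun do rewrite mxE.
by apply: measurable_funD; apply: measurableT_comp (measurable_coord_rV i) _.
Qed.

Lemma measurable_preimage_rV_translation n (a : 'rV[R]_n) A : measurable A ->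
  measurable ((fun x => x + a) @^-1` A).
Proof.
move=> mA; rewrite -[X in measurable X]setTI.
by apply: measurable_funD_rV => //; exact: measurable_cst.
Qed.

Lemma measurable_rVcons_preimage n (A : set 'rV[R]_n.+1) : measurable A ->
  measurable (@rVcons R n @^-1` A).
Proof. by move=> mA; rewrite -[X in measurable X]setTI; exact: measurable_rVcons. Qed.

(** Induction on the dimension: the sections are translated by the induction hypothesis, the first
    coordinate by invariance on the line. *)
Lemma lebesgue_rV_translation n (a : 'rV[R]_n) (A : set 'rV[R]_n) :
  measurable A -> lebesgue_rV n ((fun x => x + a) @^-1` A) = lebesgue_rV n A.
Proof.
elim: n a A => [|n IH] a A mA.
  rewrite (_ : _ @^-1` _ = A)//; apply/funext => x /=; congr A.
  by rewrite (thinmx0 (x + a)) (thinmx0 x).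
pose a' : 'rV[R]_n := \row_i a ord0 (lift ord0 i).
pose B := @rVcons R n @^-1` A.
have mB : measurable B := measurable_rVcons_preimage mA.
pose phi x := lebesgue_rV n (xsection B x).
have mphi : measurable_fun setT phi by exact: measurable_fun_xsection.
rewrite /= /lebesgue_rV_succ /pushforward /product_measure1.
transitivity (\int[mu]_x phi (x + a ord0 ord0)%R)%E.
  apply: eq_integral => x _ /=.
  rewrite /phi -[RHS](IH a'); last exact: measurable_xsection.
  congr (lebesgue_rV n _); apply/funext => y /=.
  rewrite !xsectionE /B /=; congr A; apply/rowP => i; rewrite !mxE.
  by case: unliftP => [j ->|->]; rewrite ?mxE.
pose f (x : measurableTypeR R) : measurableTypeR R := x + a ord0 ord0.
have mf : measurable_fun setT f by exact: measurable_funD.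
transitivity (\int[pushforward mu f]_x phi x)%E.
  by rewrite ge0_integral_pushforward.
apply: eq_measure_integral => C mC _.
exact: lebesgue_measure_translation.
Qed.

Lemma ge0_integral_rV_translation n (a : 'rV[R]_n) (f : 'rV[R]_n -> \bar R) :
  measurable_fun setT f -> (forall x, 0 <= f x)%E ->
  (\int[lebesgue_rV n]_x f (x + a)%R = \int[lebesgue_rV n]_x f x)%E.
Proof.
move=> mf f0; pose g (x : 'rV[R]_n) := x + a.
have mg : measurable_fun setT g.
  by apply: measurable_funD_rV => //; exact: measurable_cst.
transitivity (\int[pushforward (lebesgue_rV n) g]_x f x)%E.
  by rewrite ge0_integral_pushforward.
apply: eq_measure_integral => C mC _; exact: lebesgue_rV_translation.
Qed.

End lebesgue_rV_invariance.

(** * Euclidean inner product, reflections and cubes *)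

Section euclidean.
Context {R : realType} {n : nat}.
Implicit Types (x y z e : 'rV[R]_n) (a l : R).

Definition dot x y : R := \sum_(i < n) x ord0 i * y ord0 i.

Lemma dotC x y : dot x y = dot y x.
Proof. by apply: eq_bigr => i _; rewrite mulrC. Qed.

Lemma dotDr x y z : dot x (y + z) = dot x y + dot x z.
Proof. by rewrite /dot -big_split; apply: eq_bigr => i _; rewrite mxE mulrDr. Qed.

Lemma dotZr a x y : dot x (a *: y) = a * dot x y.
Proof. by rewrite /dot mulr_sumr; apply: eq_bigr => i _; rewrite mxE mulrCA. Qed.

Lemma dotNr x y : dot x (- y) = - dot x y.
Proof. by rewrite -scaleN1r dotZr mulN1r. Qed.

Lemma dotr0 x : dot x 0 = 0.
Proof. by rewrite -(scale0r 0) dotZr mul0r. Qed.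

Lemma dotDl x y z : dot (x + y) z = dot x z + dot y z.
Proof. by rewrite ![dot _ z]dotC dotDr. Qed.

Lemma dotZl a x y : dot (a *: x) y = a * dot x y.
Proof. by rewrite ![dot _ y]dotC dotZr. Qed.

Lemma dotNl x y : dot (- x) y = - dot x y.
Proof. by rewrite ![dot _ y]dotC dotNr. Qed.

Definition dotE := (dotDr, dotDl, dotNr, dotNl, dotZr, dotZl).

Lemma dot_ge0 x : 0 <= dot x x.
Proof. by apply: sumr_ge0 => i _; rewrite -expr2 sqr_ge0. Qed.

Lemma enormE x : enorm x = Num.sqrt (dot x x).
Proof. by []. Qed.

Lemma enorm_ge0 x : 0 <= enorm x.
Proof. exact: sqrtr_ge0. Qed.

Lemma sqr_enorm x : enorm x ^+ 2 = dot x x.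
Proof. by rewrite enormE sqr_sqrtr// dot_ge0. Qed.

Lemma enorm_eq0 x : enorm x = 0 -> x = 0.
Proof.
move=> x0; have : dot x x = 0 by rewrite -sqr_enorm x0 expr0n.
move=> /eqP; rewrite psumr_eq0; last by move=> i _; rewrite -expr2 sqr_ge0.
move=> /allP H; apply/rowP => i; rewrite mxE.
have := H i; rewrite mem_index_enum => /(_ isT) /=.
by rewrite mulf_eq0 orbb => /eqP.
Qed.

Lemma enorm0 : enorm (0 : 'rV[R]_n) = 0.
Proof. by rewrite enormE -(scale0r 0) dotZr mul0r sqrtr0. Qed.

Lemma enorm_gt0 x : x != 0 -> 0 < enorm x.
Proof.
by move=> x0; rewrite lt_def enorm_ge0 andbT; apply: contra x0 => /eqP/enorm_eq0 ->.
Qed.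

Lemma enormZ a x : enorm (a *: x) = `|a| * enorm x.
Proof.
by rewrite !enormE !dotE mulrA -expr2 sqrtrM ?sqr_ge0// sqrtr_sqr.
Qed.

Lemma enormN x : enorm (- x) = enorm x.
Proof. by rewrite !enormE !dotE opprK. Qed.

Lemma enormBC x y : enorm (x - y) = enorm (y - x).
Proof. by rewrite -enormN opprB. Qed.

Lemma dot_le x y : `|dot x y| <= enorm x * enorm y.
Proof.
have [->|y0] := eqVneq y 0.
  by rewrite enorm0 mulr0 -(scale0r 0) dotZr mul0r normr0.
have yy : 0 < dot y y by rewrite -sqr_enorm exprn_gt0// enorm_gt0.
have := dot_ge0 (dot y y *: x - dot x y *: y); rewrite !dotE (dotC y x) => H.
rewrite -(ler_pXn2r (ltn0Sn 1)) ?nnegrE ?mulr_ge0 ?enorm_ge0//.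
rewrite exprMn !sqr_enorm real_normK ?num_real// -(ler_pM2l yy).
by nra.
Qed.

Lemma dot_le_enorm x y : dot x y <= enorm x * enorm y.
Proof. exact: le_trans (ler_norm _) (dot_le x y). Qed.

Lemma enormD x y : enorm (x + y) <= enorm x + enorm y.
Proof.
rewrite -(ler_pXn2r (ltn0Sn 1)) ?nnegrE ?addr_ge0 ?enorm_ge0//.
rewrite sqrrD !sqr_enorm !dotE (dotC y x).
by have := dot_le_enorm x y; lra.
Qed.

Lemma coord_le_enorm x i : `|x ord0 i| <= enorm x.
Proof.
rewrite -(ler_pXn2r (ltn0Sn 1)) ?nnegrE ?enorm_ge0//.
rewrite sqr_enorm real_normK ?num_real// /dot (bigD1 i)//= -expr2 lerDl.
by apply: sumr_ge0 => j _; rewrite -expr2 sqr_ge0.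
Qed.

Lemma normr_le_enorm x : `|x| <= enorm x.
Proof.
rewrite /Num.norm/= mx_normrE; apply/bigmax_leP; split; first exact: enorm_ge0.
by move=> [i j] _ /=; rewrite ord1; exact: coord_le_enorm.
Qed.

Lemma enorm_le_coord x a : 0 <= a -> (forall i, `|x ord0 i| <= a) ->
  enorm x <= n%:R * a.
Proof.
move=> a0 xa; rewrite -(ler_pXn2r (ltn0Sn 1)) ?nnegrE ?enorm_ge0 ?mulr_ge0//.
rewrite sqr_enorm exprMn; apply: (@le_trans _ _ (\sum_(i < n) a ^+ 2)).
  apply: ler_sum => i _; rewrite -expr2 -(real_normK (num_real _)).
  by rewrite ler_pXn2r ?nnegrE.
rewrite sumr_const card_ord -[leLHS]mulr_natl ler_wpM2r ?sqr_ge0//.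
by rewrite -natrX ler_nat; case: (n) => // k; rewrite leq_pmulr.
Qed.

Lemma enorm_le_normr x : enorm x <= n%:R * `|x|.
Proof.
apply: enorm_le_coord => // i; rewrite [leRHS]/Num.norm/= mx_normrE.
by apply: (le_bigmax _ (fun k => `|x k.1 k.2|) (ord0, i)).
Qed.

Lemma ler_distenorm x y : `|enorm x - enorm y| <= enorm (x - y).
Proof.
rewrite ler_norml; have := enormD (x - y) y; have := enormD (y - x) x.
by rewrite !subrK (enormBC y x); lra.
Qed.

Lemma near_enorm x a : 0 < a -> \forall y \near x, enorm (y - x) < a.
Proof.
move=> a0; have n0 : 0 < n%:R + 1 :> R by rewrite ltr_wpDl.
have d0 : 0 < (n%:R + 1)^-1 * a by rewrite mulr_gt0 ?invr_gt0.
have := @cvgr_dist_lt _ _ _ (nbhs x) (nbhs_filter x) id x cvg_id _ d0.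
apply: filterS => y yx; rewrite enormBC; apply: le_lt_trans (enorm_le_normr _) _.
apply: (@le_lt_trans _ _ ((n%:R + 1) * `|x - y|)).
  by rewrite ler_wpM2r// lerDl.
by rewrite -ltr_pdivlMl.
Qed.

Lemma continuous_enorm : continuous (@enorm R n).
Proof.
move=> x; apply/(@cvgrPdist_lt _ _ _ (nbhs x) (nbhs_filter x)) => e e0.
have := near_enorm x e0; apply: filterS => y yx.
by rewrite distrC; apply: le_lt_trans (ler_distenorm _ _) _.
Qed.

Lemma continuous_dot e : continuous (dot e).
Proof.
move=> x; apply/(@cvgrPdist_lt _ _ _ (nbhs x) (nbhs_filter x)) => d d0.
have n0 : 0 < enorm e + 1 by rewrite ltr_wpDl// enorm_ge0.
have d1 : 0 < (enorm e + 1)^-1 * d by rewrite mulr_gt0 ?invr_gt0.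
have := near_enorm x d1; apply: filterS => y yx.
rewrite -dotNr -dotDr; apply: le_lt_trans (dot_le _ _) _.
rewrite enormBC; apply: (@le_lt_trans _ _ ((enorm e + 1) * enorm (y - x))).
  by rewrite ler_wpM2r ?enorm_ge0// lerDl.
by rewrite -ltr_pdivlMl.
Qed.

(** For a unit vector [e], the reflection in the hyperplane of the [y] with [dot e y = l]. *)
Definition refl e l x := x + (2 * (l - dot e x)) *: e.

Section unit_normal.
Variable e : 'rV[R]_n.
Hypothesis e1 : dot e e = 1.

Lemma dot_refl l x : dot e (refl e l x) = 2 * l - dot e x.
Proof. by rewrite /refl !dotE e1; lra. Qed.

Lemma reflK l : involutive (refl e l).
Proof.
move=> x; rewrite {1}/refl dot_refl /refl -addrA -scalerDl.
have -> : 2 * (l - dot e x) + 2 * (l - (2 * l - dot e x)) = 0 by lra.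
by rewrite scale0r addr0.
Qed.

Lemma enorm_refl l x y : enorm (refl e l x - refl e l y) = enorm (x - y).
Proof.
rewrite !enormE; congr Num.sqrt.
rewrite /refl opprD addrACA -scalerBl.
have -> : 2 * (l - dot e x) - 2 * (l - dot e y) = - (2 * dot e (x - y)).
  by rewrite !dotE; lra.
move: (x - y) => z; rewrite !(dotDl, dotDr, dotZl, dotZr) e1 (dotC z e); lra.
Qed.

Lemma continuous_refl l : continuous (refl e l).
Proof.
move=> x; apply/(@cvgrPdist_lt _ _ _ (nbhs x) (nbhs_filter x)) => d d0.
have := near_enorm x d0; apply: filterS => y yx.
by apply: le_lt_trans (normr_le_enorm _) _; rewrite enorm_refl enormBC.
Qed.

Lemma enorm_refl_l l x y : enorm (refl e l x - y) = enorm (x - refl e l y).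
Proof. by rewrite -{1}(reflK l y) enorm_refl. Qed.

(** For two points on the same side of the plane the added term is nonnegative: mirroring one of
    them moves it away from the other. The comparisons of kernels rest on this. *)
Lemma sqr_enorm_refl l x y : enorm (x - refl e l y) ^+ 2 =
  enorm (x - y) ^+ 2 + 4 * (l - dot e x) * (l - dot e y).
Proof. by rewrite !sqr_enorm /refl !dotE e1 !(dotC _ e) (dotC y x); nra. Qed.

Lemma refl_fixed l x : dot e x = l -> refl e l x = x.
Proof. by rewrite /refl => ->; rewrite subrr mulr0 scale0r addr0. Qed.

(** Splits an affine reflection into the linear one, which is additive, and a translation, so that
    invariance of the measure needs proof only for the linear part. *)
Lemma reflE0 l x : refl e l x = refl e 0 x + (2 * l) *: e.
Proof. by rewrite /refl -addrA -scalerDl; congr (_ + _ *: _); lra. Qed.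

Lemma refl0D x y : refl e 0 (x + y) = refl e 0 x + refl e 0 y.
Proof.
rewrite /refl dotDr addrACA -scalerDl; congr (_ + _ *: _); lra.
Qed.

Lemma refl0N x : refl e 0 (- x) = - refl e 0 x.
Proof. by rewrite /refl dotNr opprD -scaleNr; congr (_ + _ *: _); lra. Qed.

Lemma refl0_0 : refl e 0 0 = 0.
Proof. by rewrite /refl dotr0 subrr mulr0 scale0r addr0. Qed.

End unit_normal.

Lemma measurable_dot e : measurable_fun setT (dot e).
Proof.
apply: measurable_sum => i; apply: measurable_funM; first exact: measurable_cst.
exact: measurable_coord_rV.
Qed.

Lemma measurable_enorm : measurable_fun setT (@enorm R n).
Proof.
apply: measurableT_comp.
  by apply: continuous_measurable_fun; exact: sqrt_continuous.
by apply: measurable_sum => i; apply: measurable_funX; exact: measurable_coord_rV.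
Qed.

Lemma measurable_enormB x : measurable_fun setT (fun y => enorm (y - x)).
Proof.
apply: measurableT_comp; first exact: measurable_enorm.
by apply: measurable_funD_rV => //; exact: measurable_cst.
Qed.

Lemma measurable_eball x a : measurable (eball x a).
Proof.
rewrite (_ : eball x a = (fun y => enorm (y - x)) @^-1` `]-oo, a[%classic); last first.
  by apply/seteqP; split => y /=; rewrite in_itv.
by rewrite -[X in measurable X]setTI; exact: measurable_enormB.
Qed.

Lemma measurable_refl e l : measurable_fun setT (refl e l).
Proof.
apply: measurable_funD_rV => //; apply: measurable_fun_rV => i.
under eq_fun do rewrite mxE; apply: measurable_funM; last exact: measurable_cst.
apply: measurable_funM; first exact: measurable_cst.
by apply: measurable_funB; [exact: measurable_cst|exact: measurable_dot].
Qed.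

(** Cubes serve as test sets because the product construction gives their volume explicitly. *)
Definition box x a : set 'rV[R]_n :=
  [set y | forall i, x ord0 i - a <= y ord0 i <= x ord0 i + a].

Lemma lebesgue_rV_cube x a : 0 <= a ->
  lebesgue_rV n (box x a) = ((2 * a) ^+ n)%:E.
Proof.
move=> a0; rewrite /box.
rewrite (@lebesgue_rV_box _ _ (fun i => x ord0 i - a) (fun i => x ord0 i + a)).
  congr (_%:E); rewrite (eq_bigr (fun=> 2 * a)) => [|i _]; last by lra.
  by rewrite prodr_const card_ord.
by move=> i; lra.
Qed.

Lemma measurable_box x a : measurable (box x a).
Proof.
rewrite (_ : box _ _ = \bigcap_(i in [set: 'I_n])
    ((fun y : 'rV[R]_n => y ord0 i) @^-1`
      `[x ord0 i - a, x ord0 i + a]%classic)); last first.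
  by apply/seteqP; split => y /= xab i; [move=> _ /=|have := xab i I];
    rewrite /= in_itv/=.
apply: fin_bigcap_measurable => [|i _]; first exact: finite_finset.
by rewrite -[X in measurable X]setTI; exact: measurable_coord_rV.
Qed.

Lemma eball_sub_box x a : eball x a `<=` box x a.
Proof.
move=> y xy i; have := coord_le_enorm (y - x) i; rewrite !mxE ler_norml.
by move: xy; rewrite /eball/=; lra.
Qed.

Lemma box_enorm x a y : 0 <= a -> box x a y -> enorm (y - x) <= n%:R * a.
Proof.
move=> a0 xy; apply: enorm_le_coord => // i; rewrite !mxE ler_norml.
by have := xy i; lra.
Qed.

End euclidean.

Lemma pmule_rI {R : realDomainType} (b a c : \bar R) :
  b \is a fin_num -> (0 < b)%E -> (b * a = b * c)%E -> a = c.
Proof.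
move=> bfin b0 H; have K := lee_pmul2l bfin b0.
by apply/eqP; rewrite eq_le -K H lexx -K H lexx.
Qed.

Section reflection_invariance.
Context {R : realType} {n : nat}.
Implicit Types (x y e : 'rV[R]_n) (A : set 'rV[R]_n) (l : R).
Local Notation lam := (@lebesgue_rV R n).

Lemma eball_fin_num x (a : R) : lam (eball x a) \is a fin_num.
Proof.
have [a0|a0] := leP 0 a; last first.
  rewrite (_ : eball x a = set0) ?measure0// -subset0 => y.
  by rewrite /eball/= => /(le_lt_trans (enorm_ge0 _)); lra.
rewrite ge0_fin_numE//; apply: (@le_lt_trans _ _ (lam (box x a))).
  apply: le_measure; rewrite ?inE; [exact: measurable_eball|exact: measurable_box|].
  exact: eball_sub_box.
by rewrite lebesgue_rV_cube// ltry.
Qed.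

Lemma lebesgue_rV_eball_gt0 x (a : R) : 0 < a -> (0 < lam (eball x a))%E.
Proof.
move=> a0; pose d := a / (n%:R + 1).
have n0 : 0 < n%:R + 1 :> R by rewrite ltr_wpDl.
have d0 : 0 < d by rewrite divr_gt0.
apply: (@lt_le_trans _ _ (lam (box x d))).
  by rewrite lebesgue_rV_cube ?ltW// lte_fin exprn_gt0// mulr_gt0.
apply: le_measure; rewrite ?inE; [exact: measurable_box|exact: measurable_eball|].
move=> y /(box_enorm (ltW d0)) H; rewrite /eball/=; apply: le_lt_trans H _.
by rewrite /d mulrCA gtr_pMr// ltr_pdivrMr// mul1r ltrDl.
Qed.

Section linear_part.
Variable e : 'rV[R]_n.
Hypothesis e1 : dot e e = 1.
Local Notation rho := (refl e 0).
Local Notation B := (@eball R n 0 1).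

(* Weil's uniqueness argument for Haar measure, with [B] an isometry-invariant
   set of positive finite measure. *)
Lemma lebesgue_rV_refl0 A : measurable A -> lam (rho @^-1` A) = lam A.
Proof.
move=> mA.
have mB : measurable B by exact: measurable_eball.
have mr : measurable_fun setT rho by exact: measurable_refl.
have mrA : measurable (rho @^-1` A).
  by rewrite -[X in measurable X]setTI; exact: mr.
(* Substituting [y + rho x] for [y] turns [h2] into [h1], so by translation invariance their double
   integrals agree. With [x] integrated first, [h1] yields the measure of [B] times that of the
   preimage of [A], and [h2] the measure of [B] times that of [A]. *)
pose h1 (z : 'rV[R]_n * 'rV[R]_n) : \bar R :=
  (\1_A (rho z.1 + z.2) * \1_B z.2)%:E.
pose h2 (z : 'rV[R]_n * 'rV[R]_n) : \bar R :=
  (\1_A z.2 * \1_B (z.2 + rho (- z.1)))%:E.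
have mA1 : measurable_fun setT (\1_A : _ -> R) by exact: measurable_indic.
have mB1 : measurable_fun setT (\1_B : _ -> R) by exact: measurable_indic.
have mN : measurable_fun setT (fun x : 'rV[R]_n => - x).
  apply: measurable_fun_rV => i; under eq_fun do rewrite mxE.
  by apply: measurableT_comp => //; exact: measurable_coord_rV.
have mh1 : measurable_fun setT h1.
  apply/measurable_EFinP; apply: measurable_funM.
    apply: measurableT_comp => //; apply: measurable_funD_rV => //.
    exact: measurableT_comp.
  exact: measurableT_comp.
have mh2 : measurable_fun setT h2.
  apply/measurable_EFinP; apply: measurable_funM; first exact: measurableT_comp.
  apply: measurableT_comp => //; apply: measurable_funD_rV => //.
  by apply: measurableT_comp => //; apply: measurableT_comp.
have h10 z : (0 <= h1 z)%E by rewrite lee_fin mulr_ge0.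
have h20 z : (0 <= h2 z)%E by rewrite lee_fin mulr_ge0.
have E1 : (\int[lam]_y \int[lam]_x h1 (x, y) = lam B * lam (rho @^-1` A))%E.
  transitivity (\int[lam]_y ((\1_B y)%:E * lam (rho @^-1` A)))%E.
    apply: eq_integral => y _; rewrite /h1/=.
    transitivity (\int[lam]_x ((\1_B y)%:E * (\1_A (rho (x + rho y)%R))%:E))%E.
      apply: eq_integral => x _; rewrite -EFinM mulrC.
      by rewrite refl0D (reflK e1).
    rewrite ge0_integralZl//; last first.
    - apply/measurable_EFinP; apply: measurableT_comp => //.
      by apply: measurableT_comp => //; apply: measurable_funD_rV => //;
        exact: measurable_cst.
    rewrite (@ge0_integral_rV_translation _ _ _ (fun x => (\1_A (rho x))%:E))//; last first.
      by apply/measurable_EFinP; exact: measurableT_comp.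
    by have := @integral_indic _ _ _ lam setT measurableT _ mrA; rewrite setIT => <-.
  rewrite ge0_integralZr//; last first.
    by apply/measurable_EFinP.
  by rewrite integral_indic// setIT.
have E2 : (\int[lam]_y \int[lam]_x h2 (x, y) = lam B * lam A)%E.
  transitivity (\int[lam]_y ((\1_A y)%:E * lam B))%E.
    apply: eq_integral => y _; rewrite /h2/=.
    under eq_integral do rewrite EFinM.
    rewrite ge0_integralZl//; last first.
    - apply/measurable_EFinP; apply: measurableT_comp => //.
      by apply: measurable_funD_rV => //; exact: measurableT_comp.
    congr (_ * _)%E.
    rewrite -(lebesgue_rV_translation (- rho y) mB).
    have := @integral_indic _ _ _ lam setT measurableT _
      (measurable_preimage_rV_translation (- rho y) mB).
    rewrite setIT => <-.
    apply: eq_integral => x _; congr (_%:E).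
    rewrite !indicE; congr ((nat_of_bool _)%:R).
    (* The isometry enters here: the condition on [x] becomes membership in the unit ball about
       [rho y]. *)
    have E : enorm (y + rho (- x)) = enorm (x - rho y).
      by rewrite refl0N -(enorm_refl_l e1) enormBC.
    by apply/idP/idP; rewrite !inE /eball/= !subr0 E.
  rewrite ge0_integralZr//; last first.
    by apply/measurable_EFinP.
  by rewrite integral_indic// setIT muleC.
have : (lam B * lam (rho @^-1` A) = lam B * lam A)%E.
  have F1 := @fubini_tonelli _ _ _ _ _ lam lam h1 mh1 h10.
  have F2 := @fubini_tonelli _ _ _ _ _ lam lam h2 mh2 h20.
  apply: etrans (esym E1) (etrans (etrans (esym F1) _) (etrans F2 E2)).
  apply: eq_integral => x _.
  have mh2x := measurableT_comp mh2 (@pair1_measurable _ _ _ _ x).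
  apply: etrans _ (ge0_integral_rV_translation (rho x) mh2x (fun y => h20 (x, y))).
  apply: eq_integral => y _; rewrite /h1 /h2 /=.
  by rewrite refl0N addrK addrC.
have Bfin := eball_fin_num 0 1; have B0 := @lebesgue_rV_eball_gt0 0 1 ltr01.
exact: pmule_rI Bfin B0.
Qed.

Lemma lebesgue_rV_refl l A : measurable A -> lam (refl e l @^-1` A) = lam A.
Proof.
move=> mA; rewrite -(lebesgue_rV_translation ((2 * l) *: e) mA).
rewrite -(lebesgue_rV_refl0 (measurable_preimage_rV_translation _ mA)).
by congr (lam _); apply/funext => x /=; rewrite reflE0.
Qed.

Lemma ge0_integral_refl l A (f : 'rV[R]_n -> \bar R) : measurable A ->
  measurable_fun A f -> {in A, forall x, (0 <= f x)%E} ->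
  (\int[lam]_(x in refl e l @^-1` A) f (refl e l x) = \int[lam]_(x in A) f x)%E.
Proof.
move=> mA mf f0; have mr := measurable_refl e l.
transitivity (\int[pushforward lam (refl e l)]_(x in A) f x)%E.
  by rewrite ge0_integral_pushforward.
by apply: eq_measure_integral => C mC _; exact: lebesgue_rV_refl.
Qed.

Lemma integrable_refl l A (f : 'rV[R]_n -> R) : measurable A ->
  lam.-integrable A (EFin \o f) ->
  lam.-integrable (refl e l @^-1` A) (EFin \o (f \o refl e l)).
Proof.
move=> mA /integrableP[mf foo]; apply/integrableP; split.
  apply: (measurable_comp mA _ mf); first by move=> _ [x Ax <-].
  by apply: measurable_funTS; exact: measurable_refl.
rewrite (@ge0_integral_refl l A (fun x => `|(f x)%:E|%E))//.
exact: measurableT_comp.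
Qed.

Lemma Rintegral_refl l A (f : 'rV[R]_n -> R) : measurable A ->
  lam.-integrable A (EFin \o f) ->
  \int[lam]_(x in refl e l @^-1` A) f (refl e l x) = \int[lam]_(x in A) f x.
Proof.
move=> mA /integrableP[mf foo]; congr fine.
rewrite integralE [RHS]integralE.
rewrite -(@ge0_integral_refl l A (fun x => (EFin \o f)^\+%E x))//; last first.
  exact: measurable_funepos.
rewrite -(@ge0_integral_refl l A (fun x => (EFin \o f)^\-%E x))//; last first.
  exact: measurable_funeneg.
by congr (_ - _)%E; apply: eq_integral => x _; rewrite ?funeposE ?funenegE.
Qed.

End linear_part.

End reflection_invariance.

(** * The operator at a point and at its mirror image *)

Section continuity_rV.
Context {R : realType} {n : nat}.
Implicit Types (f g : 'rV[R]_n -> R) (x y : 'rV[R]_n) (F : R -> R).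

Definition continuous_dist f x := forall a, 0 < a -> \forall y \near x, `|f x - f y| < a.

Lemma continuous_distP f x : {for x, continuous f} <-> continuous_dist f x.
Proof.
split=> [H a a0|H]; last exact/(@cvgrPdist_lt _ _ _ (nbhs x) (nbhs_filter x)).
exact: (@cvgr_dist_lt _ _ _ (nbhs x) (nbhs_filter x) f (f x) H a a0).
Qed.

Lemma continuous_compR F f x : {for x, continuous f} -> {for f x, continuous F} ->
  {for x, continuous (F \o f)}.
Proof. exact: continuous_comp. Qed.

Lemma continuous_subR f g x : {for x, continuous f} -> {for x, continuous g} ->
  {for x, continuous (fun y => f y - g y)}.
Proof.
move=> cf cg.
by apply: (@cvgB _ _ _ (nbhs x) (nbhs_filter x) f g (f x) (g x)).
Qed.

Lemma continuous_mulR f g x : {for x, continuous f} -> {for x, continuous g} ->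
  {for x, continuous (fun y => f y * g y)}.
Proof.
move=> cf cg.
by apply: (@cvgM _ _ (nbhs x) (nbhs_filter x) f g (f x) (g x)).
Qed.

End continuity_rV.

Section Rintegral_bounds.
Context d (T : measurableType d) (R : realType) (mu : {measure set T -> \bar R}).
Implicit Types (A B : set T) (f : T -> R).

Lemma integrable_cst_fin A (c : R) : measurable A ->
  mu A \is a fin_num -> mu.-integrable A (EFin \o (fun=> c)).
Proof.
move=> mA Afin; apply/integrableP; split; first exact/measurable_EFinP.
under eq_integral do rewrite /=.
rewrite integral_cst// lte_mul_pinfty//.
by rewrite -ge0_fin_numE.
Qed.

Lemma Rintegral_le_cst A f (c : R) : measurable A -> mu A \is a fin_num ->
  mu.-integrable A (EFin \o f) -> (forall y, A y -> f y <= c) ->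
  \int[mu]_(y in A) f y <= c * fine (mu A).
Proof.
move=> mA Afin fi fc; rewrite -Rintegral_cst//.
by apply: le_Rintegral => //; exact: integrable_cst_fin.
Qed.

Lemma Rintegral_le0 A f :
  measurable A -> mu.-integrable A (EFin \o f) -> (forall y, A y -> f y <= 0) ->
  \int[mu]_(y in A) f y <= 0.
Proof.
move=> mA fi f0; have : \int[mu]_(y in A) f y <= \int[mu]_(y in A) 0.
  by apply: le_Rintegral => //; exact: integrable0.
by rewrite Rintegral_cst// mul0r.
Qed.

Lemma Rintegral_le_subset A B f (c : R) : measurable A -> measurable B ->
  B `<=` A -> mu B \is a fin_num -> mu.-integrable A (EFin \o f) ->
  (forall y, A y -> f y <= 0) -> (forall y, B y -> f y <= c) ->
  \int[mu]_(y in A) f y <= c * fine (mu B).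
Proof.
move=> mA mB BA Bfin fi f0 fc.
have mAB : measurable (A `\` B) by exact: measurableD.
rewrite -(setDUK BA) Rintegral_setU//; last 2 first.
- by rewrite setDUK.
- by apply/disj_setPS => y [By [_ nBy]]; exact: nBy By.
have h1 : \int[mu]_(y in B) f y <= c * fine (mu B).
  by apply: Rintegral_le_cst => //; exact: integrableS fi.
have h2 : \int[mu]_(y in A `\` B) f y <= 0.
  apply: Rintegral_le0 => //; last by move=> y [Ay _]; exact: f0.
  exact: integrableS (@subDsetl _ _ _) fi.
lra.
Qed.

Lemma Rintegral_setU_eq A B f C : measurable A -> measurable B ->
  A `&` B = set0 -> C = A `|` B -> mu.-integrable C (EFin \o f) ->
  \int[mu]_(y in C) f y = \int[mu]_(y in A) f y + \int[mu]_(y in B) f y.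
Proof. by move=> mA mB AB -> fi; rewrite Rintegral_setU//; apply/disj_set2P. Qed.

End Rintegral_bounds.

Section principal_value_difference.
Context {R : realType} {n : nat}.
Variables (F : R -> R) (alpha : R) (u : 'rV[R]_n -> R).
Implicit Types (x y z e : 'rV[R]_n) (l : R).
Local Notation lam := (@lebesgue_rV R n).

Definition PV x : R := lim (Ftruncated F alpha u x e @[e --> 0^'+]).

(** Substituting [refl e l y] in the truncated integral at [refl e l x] makes both integrals run
    over the complement of the same ball about [x]; this is the integrand of their difference. *)
Definition kdiff e l x y : R :=
  Fkernel F alpha u (refl e l x) (refl e l y) - Fkernel F alpha u x y.

(** Over a set invariant under the reflection its integral is twice that of [kdiff]; at a
    nonpositive minimum it has a sign. *)
Definition kdiff_sym e l x y : R := kdiff e l x y + kdiff e l x (refl e l y).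

Lemma fine_lebesgue_rV_eball_le x (a : R) : 0 <= a ->
  fine (lam (eball x a)) <= (2 * a) ^+ n.
Proof.
move=> a0; have H : (lam (eball x a) <= lam (box x a))%E.
  apply: le_measure; rewrite ?inE; [exact: measurable_eball|exact: measurable_box|].
  exact: eball_sub_box.
have cube := lebesgue_rV_cube x a0.
rewrite -lee_fin fineK; last exact: eball_fin_num.
by rewrite -cube.
Qed.

Section fixed_plane.
Variables (e : 'rV[R]_n) (l : R).
Hypothesis e1 : dot e e = 1.
Local Notation r := (refl e l).

Lemma refl_eball x (a : R) : r @^-1` (eball (r x) a) = eball x a.
Proof. by apply/funext => y; rewrite /eball/= (enorm_refl e1). Qed.

(** After the substitution only the ball about [x] is removed, so the domain consists of a symmetric
    set [D] and the ball about the mirror image of [x]. On [D] the integrand can be symmetrized; the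
    leftover ball contributes the error [M * (2 * a) ^+ n], its volume being at most that of the
    circumscribed cube. *)
Lemma Ftruncated_diff_le x z (d eta M a : R) :
  Falpha_defined F alpha u x -> Falpha_defined F alpha u (r x) ->
  dot e x < l -> 0 < a -> a < l - dot e x -> 0 <= d -> 0 <= eta -> 0 <= M ->
  (forall y, y != x -> y != r x -> kdiff_sym e l x y <= 0) ->
  (forall y, box z d y -> a <= enorm (y - x) /\ a <= enorm (y - r x)) ->
  (forall y, box z d y -> kdiff_sym e l x y <= - eta) ->
  (forall y, eball (r x) a y -> kdiff e l x y <= M) ->
  Ftruncated F alpha u (r x) a - Ftruncated F alpha u x a <=
    - (2^-1 * eta * (2 * d) ^+ n) + M * (2 * a) ^+ n.
Proof.
move=> [int2 _] [int1 _] xl a0 ad d0 eta0 M0 H0 bxa Heta HM.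
have xrx : enorm (x - r x) = 2 * (l - dot e x).
  rewrite /refl opprD addNKr enormN enormZ enormE e1 sqrtr1 mulr1 ger0_norm//.
  by rewrite mulr_ge0// subr_ge0 ltW.
pose Bx := eball x a; pose Brx := eball (r x) a.
have mBx : measurable Bx by exact: measurable_eball.
have mBrx : measurable Brx by exact: measurable_eball.
have BrxBx : Brx `<=` ~` Bx.
  rewrite /Brx /Bx /eball => y /= yrx yx.
  have := enormD (x - y) (y - r x); rewrite addrA subrK xrx (enormBC x y); lra.
pose D := ~` (Bx `|` Brx).
have mD : measurable D by apply: measurableC; exact: measurableU.
have DE : ~` Bx = D `|` Brx.
  rewrite /D setCU; apply/seteqP; split => y.
    by move=> nBx; have [|] := pselect (Brx y); [right|left].
  by move=> [[]|/BrxBx].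
have rD : r @^-1` D = D.
  rewrite /D -preimage_setC preimage_setU /Brx refl_eball /Bx.
  by rewrite -{1}(reflK e1 l x) refl_eball setUC.
pose f1 y := Fkernel F alpha u (r x) (r y); pose f2 y := Fkernel F alpha u x y.
have mCBx : measurable (~` Bx) by exact: measurableC.
have if1 : lam.-integrable (~` Bx) (EFin \o f1).
  rewrite /Bx -refl_eball preimage_setC; apply: (integrable_refl e1); last exact: int1.
  by apply: measurableC.
have if2 : lam.-integrable (~` Bx) (EFin \o f2) by exact: int2.
have T1 : Ftruncated F alpha u (r x) a = \int[lam]_(y in ~` Bx) f1 y.
  rewrite /Ftruncated -(Rintegral_refl e1 l _ (int1 _ a0)); last exact: measurableC.
  by rewrite -preimage_setC refl_eball.
pose G := kdiff e l x.
have iG : lam.-integrable (~` Bx) (EFin \o G).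
  by apply: eq_integrable (integrableB mCBx if1 if2).
have TG : Ftruncated F alpha u (r x) a - Ftruncated F alpha u x a =
    \int[lam]_(y in ~` Bx) G y by rewrite T1; exact: esym (RintegralB mCBx if1 if2).
have DBx : D `<=` ~` Bx by rewrite DE; exact: subsetUl.
have iGD : lam.-integrable D (EFin \o G) by exact: integrableS iG.
have iGB : lam.-integrable Brx (EFin \o G) by exact: integrableS iG.
have iGrD : lam.-integrable D (EFin \o (G \o r)).
  by rewrite -{1}rD; exact: (integrable_refl e1).
pose H := kdiff_sym e l x.
have iH : lam.-integrable D (EFin \o H).
  by apply: eq_integrable (integrableD mD iGD iGrD).
have HD : \int[lam]_(y in D) H y = 2 * \int[lam]_(y in D) G y.
  rewrite [LHS](RintegralD mD iGD iGrD) -{2}rD (Rintegral_refl e1 l mD iGD).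
  by rewrite mulr_natl mulr2n.
have mK : measurable (box z d) by exact: measurable_box.
have KD : box z d `<=` D.
  move=> y /bxa[h1 h2] [yB|yB]; move: yB; rewrite /Bx /Brx /eball/= => yB.
    by move: (lt_le_trans yB h1); rewrite ltxx.
  by move: (lt_le_trans yB h2); rewrite ltxx.
have Kval := lebesgue_rV_cube z d0.
have Kfin : lam (box z d) \is a fin_num by rewrite Kval.
have fineK' : fine (lam (box z d)) = (2 * d) ^+ n.
  by apply: EFin_inj; rewrite fineK; [exact: Kval|exact: Kfin].
have HD0 y : D y -> H y <= 0.
  move=> Dy; apply: H0; apply/eqP => yE; apply: Dy; rewrite yE.
    by left; rewrite /Bx /eball/= subrr enorm0.
  by right; rewrite /Brx /eball/= subrr enorm0.
have intD := Rintegral_le_subset mD mK KD Kfin iH HD0 Heta.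
rewrite fineK' HD in intD.
have Bfin := eball_fin_num (r x) a.
have Bval := fine_lebesgue_rV_eball_le (r x) (ltW a0).
have intB := Rintegral_le_cst mBrx Bfin iGB HM.
have MB : M * fine (lam Brx) <= M * (2 * a) ^+ n by exact: ler_wpM2l M0 _ _ Bval.
have DB0 : D `&` Brx = set0.
  by rewrite -subset0 => y [Dy By]; apply: Dy; right.
have sp := Rintegral_setU_eq mD mBrx DB0 DE iG.
move: TG intD intB MB; rewrite sp.
move: (\int[lam]_(y in D) G y) (\int[lam]_(y in Brx) G y) (fine (lam Brx)) => I J b.
move: (Ftruncated _ _ _ _ _) (Ftruncated _ _ _ _ _) => T1' T2'.
by lra.
Qed.

End fixed_plane.
End principal_value_difference.

Lemma mul_exprn_le {R : realType} (n : nat) (M b t : R) : (1 <= n)%N ->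
  0 <= M -> 0 < b -> b <= 1 -> 0 < t -> b <= t / (M * 2 ^+ n + 1) ->
  M * (2 * b) ^+ n <= t.
Proof.
move=> n1 M0 b0 b1 t0 bt; have K0 : 0 < M * 2 ^+ n + 1.
  by rewrite ltr_wpDl// mulr_ge0// exprn_ge0.
apply: (@le_trans _ _ ((M * 2 ^+ n + 1) * b)); last by rewrite mulrC -ler_pdivlMr.
rewrite exprMn mulrA; apply: ler_pM.
- by rewrite mulr_ge0// exprn_ge0.
- by rewrite exprn_ge0// ltW.
- by rewrite lerDl.
- by case: n n1 {bt K0} => // m _; rewrite exprS ler_piMr//;
    [exact: ltW|apply: exprn_ile1 => //; exact: ltW].
Qed.

Lemma ler_dist1 {R : realType} (a b : R) : `|a - b| < 1 -> b <= `|a| + 1.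
Proof. by rewrite ltr_norml => H; have := ler_norm a; lra. Qed.

Lemma lim_sub_le {R : realType} (f g : R -> R) (c : R) :
  cvg (f t @[t --> 0^'+]) -> cvg (g t @[t --> 0^'+]) ->
  (forall a, 0 < a -> \forall t \near 0^'+, f t - g t <= c + a) ->
  lim (f t @[t --> 0^'+]) - lim (g t @[t --> 0^'+]) <= c.
Proof.
move=> cf cg H; apply/ler_addgt0Pr => a a0.
by rewrite -limB//; apply: limr_le; [exact: is_cvgB|exact: H].
Qed.

Section principal_value_limit.
Context {R : realType} {n : nat}.
Variables (F : R -> R) (alpha : R) (u : 'rV[R]_n -> R).
Implicit Types (x y z e : 'rV[R]_n) (l : R).

Lemma near_eball x (P : 'rV[R]_n -> Prop) : (\forall y \near x, P y) ->
  exists2 a : R, 0 < a & forall y, enorm (y - x) < a -> P y.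
Proof.
move=> /nbhs_normP[a /= a0 aP]; exists a => // y yx; apply: aP.
by rewrite /ball_/= -normrN opprB; exact: le_lt_trans (normr_le_enorm _) yx.
Qed.

Definition riesz (p : R) x y : R := (enorm (x - y) `^ p)^-1.

Lemma riesz_ge0 p x y : 0 <= riesz p x y.
Proof. by rewrite invr_ge0 powR_ge0. Qed.

Lemma continuous_riesz p x y : x != y -> {for y, continuous (riesz p x)}.
Proof.
move=> xy; have xy0 : 0 < enorm (x - y) by rewrite enorm_gt0// subr_eq0.
have c1 : {for y, continuous (fun y => enorm (x - y))}.
  apply/continuous_distP => a a0; have := near_enorm y a0; apply: filterS => w wy.
  apply: le_lt_trans (ler_distenorm _ _) _.
  by rewrite opprB addrC addrA subrK.
apply: (@continuous_compR _ _ (fun t => (t `^ p)^-1) (fun y => enorm (x - y)) y c1).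
apply: continuousV; first by rewrite gt_eqF// powR_gt0.
exact: continuous_powR_gt0.
Qed.

Section fixed_plane.
Variables (e : 'rV[R]_n) (l : R).
Hypothesis e1 : dot e e = 1.
Local Notation r := (refl e l).

Lemma kdiffE x y : kdiff F alpha u e l x y =
  (F (u (r x) - u (r y)) - F (u x - u y)) * riesz (n%:R + alpha) x y.
Proof. by rewrite /kdiff /Fkernel (enorm_refl e1) /riesz mulrBl. Qed.

Lemma kdiff_symE x y : kdiff_sym F alpha u e l x y =
  (F (u (r x) - u (r y)) - F (u x - u y)) * riesz (n%:R + alpha) x y +
  (F (u (r x) - u y) - F (u x - u (r y))) * riesz (n%:R + alpha) x (r y).
Proof. by rewrite /kdiff_sym !kdiffE (reflK e1). Qed.

Lemma kdiff_sym_refl x y : kdiff_sym F alpha u e l x (r y) = kdiff_sym F alpha u e l x y.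
Proof. by rewrite /kdiff_sym (reflK e1); exact: addrC. Qed.

Hypotheses (F_cont : continuous F) (u_cont : continuous u).

Lemma continuous_kdiff x y : x != y -> {for y, continuous (kdiff F alpha u e l x)}.
Proof.
move=> xy; rewrite (_ : kdiff _ _ _ _ _ _ = fun y =>
  (F (u (r x) - u (r y)) - F (u x - u y)) * riesz (n%:R + alpha) x y); last first.
  by apply/funext => w; exact: kdiffE.
apply: continuous_mulR; last exact: continuous_riesz.
have cst (c : R) : {for y, continuous (fun=> c : R)} by exact: cst_continuous.
apply: continuous_subR.
  apply: (@continuous_compR _ _ F (fun y => u (r x) - u (r y))); last exact: F_cont.
  apply: continuous_subR; first exact: cst.
  by apply: continuous_comp; [exact: continuous_refl|exact: u_cont].
apply: (@continuous_compR _ _ F (fun y => u x - u y)); last exact: F_cont.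
by apply: continuous_subR; [exact: cst|exact: u_cont].
Qed.

Lemma refl_neq x : dot e x < l -> x != r x.
Proof.
move=> xl; apply/eqP => /(congr1 (dot e)); rewrite (dot_refl e1); lra.
Qed.

(** The leftover term disappears with the radius: [kdiff] is singular in [y] only at [x], so
    continuity bounds it near [r x], and [n >= 1] makes the volume of the leftover ball tend to
    0. *)
Lemma PV_diff_le x z (d eta a : R) : (1 <= n)%N ->
  Falpha_defined F alpha u x -> Falpha_defined F alpha u (r x) ->
  dot e x < l -> 0 < a -> 0 <= d -> 0 <= eta ->
  (forall y, y != x -> y != r x -> kdiff_sym F alpha u e l x y <= 0) ->
  (forall y, box z d y -> a <= enorm (y - x) /\ a <= enorm (y - r x)) ->
  (forall y, box z d y -> kdiff_sym F alpha u e l x y <= - eta) ->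
  PV F alpha u (r x) - PV F alpha u x <= - (2^-1 * eta * (2 * d) ^+ n).
Proof.
move=> n1 dx drx xl a0 d0 eta0 H0 bxa Heta.
have /continuous_distP /(_ _ ltr01) /near_eball [a' a'0 Ha'] :=
  continuous_kdiff (refl_neq xl).
pose M := `|kdiff F alpha u e l x (r x)| + 1.
have M0 : 0 <= M by rewrite addr_ge0.
have HM y : enorm (y - r x) < a' -> kdiff F alpha u e l x y <= M.
  by move=> /Ha' /ler_dist1.
apply: (lim_sub_le drx.2 dx.2) => t t0.
pose K := M * 2 ^+ n + 1.
have K0 : 0 < K by rewrite ltr_wpDl// mulr_ge0// exprn_ge0.
near=> b.
have b0 : 0 < b by near: b; exact: nbhs_right_gt.
have ba : b <= a by near: b; apply: nbhs_right_le.
have ba' : b <= a' by near: b; apply: nbhs_right_le.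
have b1 : b <= 1 by near: b; apply: nbhs_right_le.
have bd : b < l - dot e x by near: b; apply: nbhs_right_lt; rewrite subr_gt0.
have bK : b <= t / K by near: b; apply: nbhs_right_le; rewrite divr_gt0.
have := @Ftruncated_diff_le R n F alpha u e l e1 x z d eta M b dx drx xl b0 bd d0
  eta0 M0 H0.
have h1 y : box z d y -> b <= enorm (y - x) /\ b <= enorm (y - r x).
  by move=> /bxa[? ?]; split; exact: le_trans ba _.
have h2 y : eball (r x) b y -> kdiff F alpha u e l x y <= M.
  by move=> yb; apply: HM; exact: lt_le_trans yb ba'.
move=> /(_ h1 Heta h2) h.
have h3 := mul_exprn_le n1 M0 b0 b1 t0 bK.
by apply: le_trans h _; rewrite lerD2l.
Unshelve. all: by end_near. Qed.

End fixed_plane.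
End principal_value_limit.

(** * Maximum principles for the reflected difference *)

Lemma half_triangle {R : realFieldType} (a b s t : R) :
  a <= b / 2 -> s < a -> b <= s + t -> a <= t.
Proof. lra. Qed.

Lemma cancel_factor {R : realFieldType} (c V B E A D N : R) : E * D = 1 ->
  - (2^-1 * - (2 * c * V * (B * (E * A))) * (D * N)) = c * (B * N) * V * A.
Proof.
move=> DD; transitivity ((E * D) * (c * V * B * A * N)); first by lra.
by rewrite DD; lra.
Qed.

Lemma powR_inv_antitone {R : realType} (p a b : R) : 0 < p -> 0 < a -> a <= b ->
  (b `^ p)^-1 <= (a `^ p)^-1.
Proof.
move=> p0 a0 ab; have b0 := lt_le_trans a0 ab.
by rewrite lef_pV2 ?posrE ?powR_gt0// ge0_ler_powR ?nnegrE// ltW.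
Qed.

Lemma powR_inv_antitone_lt {R : realType} (p a b : R) : 0 < p -> 0 < a -> a < b ->
  (b `^ p)^-1 < (a `^ p)^-1.
Proof.
move=> p0 a0 ab; have b0 := lt_trans a0 ab.
by rewrite ltf_pV2 ?posrE ?powR_gt0// gt0_ltr_powR ?nnegrE// ltW.
Qed.

Lemma ler_weighted_sum {R : realType} (N1 N2 k1 k2 c : R) :
  N1 <= 0 -> k2 <= k1 -> 0 <= k2 -> N1 + N2 <= c -> N1 * k1 + N2 * k2 <= c * k2.
Proof.
move=> N10 k21 k20 Nc.
have : N1 * k1 <= N1 * k2 by rewrite ler_wnM2l.
have : (N1 + N2) * k2 <= c * k2 by rewrite ler_wpM2r.
by rewrite mulrDl; lra.
Qed.

Section reflected_difference.
Context {R : realType} {n : nat}.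
Variables (F : R -> R) (alpha c0 : R) (u : 'rV[R]_n -> R).
Implicit Types (x y z : 'rV[R]_n).
Hypothesis n1 : (1 <= n)%N.
Hypothesis alpha0 : 0 < alpha.
Hypothesis c0_gt0 : 0 < c0.
Hypothesis F_mono : forall a b, a <= b -> c0 * (b - a) <= F b - F a.
Hypotheses (F_cont : continuous F) (u_cont : continuous u).
Hypothesis u_pv_defined : forall x, Falpha_defined F alpha u x.

(* A cube of half-width [d / 2n] centred at [x + 3 d e] lies beyond the plane and
   within distance [4 d] of [x]; integrating the kernel over it gives this constant. *)
Definition cube_const : R := 4 `^ (- (n%:R + alpha)) * (n%:R ^+ n)^-1.

Let n0 : 0 < n%:R :> R. Proof. by rewrite ltr0n. Qed.
Let p0 : 0 < n%:R + alpha. Proof. by rewrite addr_gt0. Qed.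

Lemma cube_const_gt0 : 0 < cube_const.
Proof. by rewrite mulr_gt0 ?powR_gt0// invr_gt0 exprn_gt0. Qed.

Lemma riesz_antitone x y z : x != y -> enorm (x - y) <= enorm (x - z) ->
  riesz (n%:R + alpha) x z <= riesz (n%:R + alpha) x y.
Proof.
move=> xy h; have xy0 : 0 < enorm (x - y) by rewrite enorm_gt0// subr_eq0.
exact: powR_inv_antitone p0 xy0 h.
Qed.

Section fixed_plane.
Variables (e : 'rV[R]_n) (l : R).
Hypothesis e1 : dot e e = 1.
Local Notation r := (refl e l).
Local Notation H := (kdiff_sym F alpha u e l).
Local Notation k := (riesz (n%:R + alpha)).

Definition refl_diff x : R := u (r x) - u x.
Local Notation U := refl_diff.

Lemma refl_diff_refl x : U (r x) = - U x.
Proof. by rewrite /refl_diff (reflK e1) opprB. Qed.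

Lemma refl_diff_plane x : dot e x = l -> U x = 0.
Proof. by move=> xl; rewrite /refl_diff refl_fixed// subrr. Qed.

Lemma continuous_refl_diff : continuous U.
Proof.
move=> x; apply: continuous_subR; last exact: u_cont.
by apply: continuous_comp; [exact: continuous_refl|exact: u_cont].
Qed.

Lemma enorm_refl_ge x y : dot e x <= l -> dot e y <= l ->
  enorm (x - y) <= enorm (x - r y).
Proof.
move=> xl yl; rewrite -(ler_pXn2r (ltn0Sn 1)) ?nnegrE ?enorm_ge0//.
rewrite (sqr_enorm_refl e1 l x y) lerDl.
by rewrite mulr_ge0 ?mulr_ge0 ?subr_ge0.
Qed.

Lemma riesz_refl_le x y : dot e x <= l -> dot e y <= l -> x != y ->
  k x (r y) <= k x y.
Proof. by move=> xl yl xy; apply: riesz_antitone => //; exact: enorm_refl_ge. Qed.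

Lemma riesz_refl_lt x y : dot e x < l -> dot e y < l -> x != y ->
  k x (r y) < k x y.
Proof.
move=> xl yl xy; have xy0 : 0 < enorm (x - y) by rewrite enorm_gt0// subr_eq0.
have h : enorm (x - y) < enorm (x - r y).
  rewrite -(ltr_pXn2r (ltn0Sn 1)) ?nnegrE ?enorm_ge0//.
  by rewrite (sqr_enorm_refl e1 l x y) ltrDl mulr_gt0 ?mulr_gt0 ?subr_gt0.
exact: powR_inv_antitone_lt p0 xy0 h.
Qed.

Lemma F_diff_le x y : U x <= U y ->
  F (u (r x) - u (r y)) - F (u x - u y) <= - (c0 * (U y - U x)).
Proof.
move=> xy; have h : u (r x) - u (r y) <= u x - u y by move: xy; rewrite /refl_diff; lra.
have := F_mono h.
have -> : u x - u y - (u (r x) - u (r y)) = U y - U x by rewrite /refl_diff; lra.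
move: (F _) (F _) (c0 * _) => A B C; lra.
Qed.

(* Pairing [y] with its mirror image makes oddness of [F] unnecessary. *)
Lemma F_cross_le x (t s : R) : U x <= 0 ->
  F (u (r x) - t) - F (u x - t) + (F (u (r x) - s) - F (u x - s)) <= 2 * c0 * U x.
Proof.
rewrite /refl_diff; move: (u (r x)) (u x) => a b ab.
have h1 : a - t <= b - t by lra.
have h2 : a - s <= b - s by lra.
have := F_mono h1; have := F_mono h2.
have -> : b - t - (a - t) = b - a by lra.
have -> : b - s - (a - s) = b - a by lra.
move: (F _) (F _) (F _) (F _) => A B C D; lra.
Qed.

(** The term with the larger weight [k x y] is nonpositive by minimality at [x], so lowering its
    weight to [k x (r y)] only increases the sum; the two increments of [F] together are then
    bounded by [F_cross_le]. *)
Lemma kdiff_sym_le x y : dot e x <= l -> dot e y <= l -> x != y ->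
  U x <= 0 -> U x <= U y -> H x y <= 2 * c0 * U x * k x (r y).
Proof.
move=> xl yl xy U0 Uxy; rewrite (kdiff_symE F alpha u l e1).
apply: ler_weighted_sum; last 1 first.
- have := F_cross_le (u (r y)) (u y) U0.
  by move: (F _) (F _) (F _) (F _) => A B C D; lra.
- apply: le_trans (F_diff_le Uxy) _.
  by rewrite oppr_le0; apply: mulr_ge0; [exact: ltW|rewrite subr_ge0].
- exact: riesz_refl_le.
- exact: riesz_ge0.
Qed.

(** If [U x = 0], then [u] agrees at [x] and at its mirror image, so the two increments of [F] are
    opposite and the difference of the kernels factors out. *)
Lemma kdiff_sym_touching x y : U x = 0 -> U x <= U y -> k x (r y) <= k x y ->
  H x y <= - (c0 * U y * (k x y - k x (r y))).
Proof.
move=> U0 Uxy kk; rewrite (kdiff_symE F alpha u l e1).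
have ux : u (r x) = u x by exact: subr0_eq U0.
have := F_diff_le Uxy; rewrite U0 subr0 ux.
move: (F _) (F _) => A B h.
have : (B - A) * (k x y - k x (r y)) <= - (c0 * U y) * (k x y - k x (r y)).
  by apply: ler_wpM2r => //; rewrite subr_ge0.
clear kk Uxy U0 ux; move: (k x y) (k x (r y)) => a b; lra.
Qed.

Section witness_box.
Variable x : 'rV[R]_n.
Hypothesis xl : dot e x < l.
Let d := l - dot e x.
Let d0 : 0 < d. Proof. by rewrite subr_gt0. Qed.

Lemma far_boxP y : box (x + (3 * d) *: e) (d / (2 * n%:R)) y ->
  [/\ l < dot e y, enorm (y - x) <= 4 * d,
      d / 2 <= enorm (y - x) & d / 2 <= enorm (y - r x)].
Proof.
set z := x + _ => yB.
have ne : enorm e = 1 by rewrite enormE e1 sqrtr1.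
have yz : enorm (y - z) <= d / 2.
  have h : 0 <= d / (2 * n%:R) by rewrite divr_ge0 ?mulr_ge0// ltW.
  apply: le_trans (box_enorm h yB) _.
  by rewrite invfM mulrCA [n%:R * _]mulrCA mulfV ?gt_eqF// mulr1.
have zx : enorm (z - x) = 3 * d.
  rewrite /z addrAC subrr add0r enormZ ne mulr1 ger0_norm//.
  by rewrite mulr_ge0// ltW.
have zrx : enorm (z - r x) = d.
  rewrite /z /refl opprD addrACA subrr add0r -scalerBl enormZ ne mulr1.
  by rewrite -/d (_ : 3 * d - 2 * d = d) ?gtr0_norm//; lra.
have ez : dot e z = dot e x + 3 * d by rewrite /z dotDr dotZr e1 mulr1.
have h1 : dot e y = dot e (y - z) + dot e z by rewrite -dotDr subrK.
have h2 := dot_le e (y - z); rewrite ne mul1r in h2.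
have h3 := ler_norm (- dot e (y - z)); rewrite normrN in h3.
have h4 := enormD (y - z) (z - x); rewrite addrA subrK in h4.
have h5 := enormD (z - y) (y - x); rewrite addrA subrK (enormBC z y) in h5.
have h6 := enormD (z - y) (y - r x); rewrite addrA subrK (enormBC z y) in h6.
rewrite zx in h4 h5; rewrite zrx in h6; rewrite ez in h1.
have dE : dot e x = l - d by rewrite /d; lra.
rewrite dE in h1.
move: h1 h2 h3 h4 h5 h6 yz d0.
move: (dot e (y - z)) (dot e y) (enorm (y - z)) (enorm (y - x)) (enorm (y - r x)).
by move=> a b c f g; move: d => t; move=> *; split; lra.
Qed.

Lemma kdiff_sym_le0 : U x <= 0 -> (forall y, dot e y <= l -> U x <= U y) ->
  forall y, y != x -> y != r x -> H x y <= 0.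
Proof.
move=> U0 Umin y yx yrx.
have below w : dot e w <= l -> w != x -> H x w <= 0.
  move=> wl wx; apply: le_trans (kdiff_sym_le (ltW xl) wl _ U0 (Umin _ wl)) _.
    by rewrite eq_sym.
  rewrite mulr_le0_ge0 ?riesz_ge0// mulr_ge0_le0// mulr_ge0// ltW//.
have [yl|yl] := leP (dot e y) l; first exact: below.
rewrite -(kdiff_sym_refl F alpha u l e1); apply: below.
  by rewrite (dot_refl e1); move: yl; lra.
by apply: contra yrx => /eqP <-; rewrite (reflK e1).
Qed.

Lemma PV_diff_min : U x <= 0 -> (forall y, dot e y <= l -> U x <= U y) ->
  PV F alpha u (r x) - PV F alpha u x <= c0 * cube_const * U x * d `^ (- alpha).
Proof.
move=> U0 Umin; pose eta := - (2 * c0 * U x * (4 * d) `^ (- (n%:R + alpha))).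
have eta0 : 0 <= eta.
  by rewrite oppr_ge0 mulr_le0_ge0 ?powR_ge0// mulr_ge0_le0// mulr_ge0// ltW.
have dh0 : 0 <= d / (2 * n%:R) by rewrite divr_ge0 ?mulr_ge0// ltW.
have d20 : 0 < d / 2 by rewrite divr_gt0.
have := @PV_diff_le R n F alpha u e l e1 F_cont u_cont x (x + (3 * d) *: e)
  (d / (2 * n%:R)) eta (d / 2) n1 (u_pv_defined x) (u_pv_defined (r x)) xl d20 dh0 eta0
  (kdiff_sym_le0 U0 Umin).
have h1 y : box (x + (3 * d) *: e) (d / (2 * n%:R)) y ->
    d / 2 <= enorm (y - x) /\ d / 2 <= enorm (y - r x) by move=> /far_boxP[].
have h2 y : box (x + (3 * d) *: e) (d / (2 * n%:R)) y -> H x y <= - eta.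
  move=> /far_boxP[yl y4 y2 y3]; rewrite opprK.
  have ryl : dot e (r y) <= l by rewrite (dot_refl e1); move: yl; lra.
  have xry : x != r y.
    apply/eqP => xE; move: y3; rewrite xE (reflK e1) subrr enorm0.
    by rewrite leNgt d20.
  (* The bound of [kdiff_sym_le] carries the kernel at the point beyond the plane. Applied to [r y]
     it carries [k x y], which is bounded below on the cube; hence the place of the cube. *)
  rewrite -(kdiff_sym_refl F alpha u l e1).
  apply: le_trans (kdiff_sym_le (ltW xl) ryl xry U0 (Umin _ ryl)) _.
  rewrite (reflK e1); apply: ler_wnM2l.
    by rewrite mulr_ge0_le0// mulr_ge0// ltW.
  rewrite powRN /riesz (enormBC x y).
  exact: powR_inv_antitone p0 (lt_le_trans d20 y2) y4.
move=> /(_ h1 h2) h; apply: le_trans h _.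
rewrite le_eqVlt; apply/orP; left; apply/eqP.
have -> : 2 * (d / (2 * n%:R)) = d / n%:R by rewrite invfM mulrCA mulVKf.
rewrite /eta /cube_const powRM ?ltW// expr_div_n.
have -> : d `^ (- (n%:R + alpha)) = (d ^+ n)^-1 * d `^ (- alpha).
  rewrite opprD powRD ?(gt_eqF d0) ?implybT//; congr (_ * _).
  by rewrite powRN powR_mulrn// ltW.
have dn0 : d ^+ n != 0 by rewrite expf_neq0// gt_eqF.
have DD : (d ^+ n)^-1 * d ^+ n = 1 by rewrite mulVf.
exact: cancel_factor DD.
Qed.

Lemma PV_diff_touching : U x = 0 -> (forall y, dot e y <= l -> 0 <= U y) ->
  PV F alpha u (r x) - PV F alpha u x <= 0.
Proof.
move=> U0 Uge; have := PV_diff_min; rewrite U0 => /(_ (lexx 0) Uge).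
by rewrite mulr0 mul0r.
Qed.

(** Strong maximum principle: by continuity the bound of [kdiff_sym_touching] stays negative on a
    small cube around [y0], and this cube already makes the difference strictly negative. *)
Lemma PV_diff_strong y0 : U x = 0 -> (forall y, dot e y <= l -> 0 <= U y) ->
  dot e y0 < l -> 0 < U y0 -> PV F alpha u (r x) - PV F alpha u x < 0.
Proof.
move=> U0 Uge yl Uy0.
have xy0 : x != y0 by apply/eqP => xE; move: Uy0; rewrite -xE U0 ltxx.
have rxy0 : r x != y0.
  by apply/eqP => xE; move: yl; rewrite -xE (dot_refl e1); move: xl; lra.
pose h y := c0 * U y * (k x y - k x (r y)).
have h0 : 0 < h y0 by rewrite mulr_gt0 ?mulr_gt0// subr_gt0; exact: riesz_refl_lt.
have ch : {for y0, continuous h}.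
  apply: continuous_mulR.
    apply: continuous_mulR; [exact: cst_continuous|exact: continuous_refl_diff].
  apply: continuous_subR; first exact: continuous_riesz.
  apply: (@continuous_comp _ _ _ r (k x)); first exact: continuous_refl.
  apply: continuous_riesz; apply/eqP => xE; move: xl yl.
  by rewrite xE (dot_refl e1); lra.
pose eta := h y0 / 2.
have eta0 : 0 < eta by rewrite divr_gt0.
have /continuous_distP /(_ _ eta0) /near_eball [a1 a10 Ha1] := ch.
have yl0 : 0 < l - dot e y0 by rewrite subr_gt0.
have /continuous_distP /(_ _ yl0) /near_eball [a2 a20 Ha2] := @continuous_dot _ _ e y0.
pose b1 := enorm (y0 - x); pose b2 := enorm (y0 - r x).
have b10 : 0 < b1 by rewrite enorm_gt0// subr_eq0 eq_sym.
have b20 : 0 < b2 by rewrite enorm_gt0// subr_eq0 eq_sym.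
(* Within distance [a] of [y0], [h] stays above [h y0 / 2], the points stay below the plane, and
   they keep a distance of at least [a] from [x] and from [r x]. *)
pose a := Num.min (Num.min a1 a2) (Num.min (b1 / 2) (b2 / 2)).
have a0 : 0 < a by rewrite !lt_min a10 a20 !divr_gt0.
have [[aa1 aa2] [ab1 ab2]] : (a <= a1 /\ a <= a2) /\ (a <= b1 / 2 /\ a <= b2 / 2).
  have : a <= a by [].
  by rewrite {2}/a !le_min => /andP[/andP[-> ->] /andP[-> ->]].
pose d' := a / (2 * n%:R).
have d'0 : 0 < d' by rewrite divr_gt0// mulr_gt0.
have near w : box y0 d' w -> enorm (w - y0) < a.
  move=> /(box_enorm (ltW d'0)) /le_lt_trans; apply.
  rewrite /d' invfM mulrCA [n%:R * _]mulrCA mulfV ?gt_eqF// mulr1.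
  by move: a0; lra.
have far (b : R) w v : a <= b / 2 -> b = enorm (y0 - v) -> box y0 d' w ->
    a <= enorm (w - v).
  move=> ab bE /near wa; have := enormD (y0 - w) (w - v).
  rewrite addrA subrK -bE (enormBC y0 w) => h1.
  exact: half_triangle ab wa h1.
have H0 := kdiff_sym_le0.
have U00 : U x <= 0 by rewrite U0.
have Umin y : dot e y <= l -> U x <= U y by rewrite U0; exact: Uge.
have hbox w : box y0 d' w -> H x w <= - eta.
  move=> /near wa.
  have wl : dot e w <= l.
    have := Ha2 _ (lt_le_trans wa aa2); move: (dot e w) (dot e y0) => s t.
    by rewrite ltr_norml; lra.
  have xw : x != w.
    apply/eqP => xE; move: wa; rewrite -xE enormBC -/b1.
    by move: ab1 b10; lra.
  apply: le_trans (kdiff_sym_touching U0 (Umin _ wl) (riesz_refl_le (ltW xl) wl xw)) _.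
  rewrite lerN2 -/(h w).
  have := Ha1 _ (lt_le_trans wa aa1); rewrite /eta ltr_norml.
  by move: (h w) (h y0) => s t; lra.
have := @PV_diff_le R n F alpha u e l e1 F_cont u_cont x y0 d' eta a n1 (u_pv_defined x)
  (u_pv_defined (r x)) xl a0 (ltW d'0) (ltW eta0) (H0 U00 Umin).
move=> /(_ _ hbox) /le_lt_trans; apply.
  by move=> w wB; split; [exact: far ab1 erefl wB|exact: far ab2 erefl wB].
by rewrite oppr_lt0 mulr_gt0 ?exprn_gt0// mulr_gt0.
Qed.

End witness_box.
End fixed_plane.
End reflected_difference.

(** * Power inequalities and absorption of the coefficients *)

Section powR_estimates.
Context {R : realType}.

Lemma powR_sub_le (p a b : R) : 1 < p -> 0 < b -> b <= a ->
  a `^ p - b `^ p <= p * a `^ (p - 1) * (a - b).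
Proof.
move=> p1 b0; rewrite le_eqVlt => /orP[/eqP->|ba]; first by rewrite !subrr mulr0.
have pos t : t \in `]b, a[ -> 0 < t by rewrite in_itv/= => /andP[bt _]; exact: lt_trans bt.
have dp t : t \in `]b, a[ -> is_derive t 1 (@powR R ^~ p) (p * t `^ (p - 1)).
  by move=> /pos t0; exact: is_derive1_powR.
have cp : {within `[b, a], continuous (@powR R ^~ p)}.
  apply: continuous_in_subspaceT => t; rewrite inE/= in_itv/= => /andP[bt _].
  by apply: continuous_powR_gt0; exact: lt_le_trans bt.
have [t tI ->] := MVT ba dp cp.
have t0 := pos t tI; move: tI; rewrite in_itv/= => /andP[bt ta].
rewrite ler_wpM2r ?subr_ge0 ?(ltW ba)// ler_wpM2l//; first lra.
by rewrite ge0_ler_powR ?nnegrE//; lra.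
Qed.

Lemma ler_powR2r (p a b : R) : 0 <= p -> 0 <= a -> a <= b -> a `^ p <= b `^ p.
Proof. by move=> p0 a0 ab; rewrite ge0_ler_powR ?nnegrE//; exact: le_trans ab. Qed.

(* [a] is the order of the operator and [b > a] the decay rate of a coefficient:
   the coefficient is absorbed far out, and also close to the reflecting plane. *)
Lemma absorb_far_or_near (T : Type) (N g : T -> R) (C rho M K a b : R) :
  0 < a -> a < b -> 0 < K -> 0 <= C -> 0 < rho -> 0 <= M ->
  (forall x, rho <= N x -> g x <= C * N x `^ (- b)) -> (forall x, g x <= M) ->
  exists R0 d0 : R, [/\ 0 < R0, 0 < d0 & forall x d, 0 < d ->
    (R0 <= N x /\ d <= 2 * N x) \/ d <= d0 -> g x <= K * d `^ (- a)].
Proof.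
move=> a0 ab K0 C0 rho0 M0 far bnd.
(* [C N^(-b) <= K (2 N)^(-a)] amounts to [Q <= N^(b - a)], and [M <= K d^(-a)] follows from
   [d^a <= K / (M + 1)]; [R0] and [d0] are chosen to meet these two conditions. *)
pose Q := C * 2 `^ a / K.
have Q0 : 0 <= Q by rewrite divr_ge0 ?mulr_ge0 ?powR_ge0// ltW.
pose R0 := Num.max rho ((Q + 1) `^ (b - a)^-1).
pose d0 := (K / (M + 1)) `^ a^-1.
have M1 : 0 < M + 1 by lra.
have KM : 0 < K / (M + 1) by rewrite divr_gt0.
exists R0, d0; split; first by rewrite lt_max rho0.
  by rewrite powR_gt0.
move=> x d dpos [[Rx dx]|dd].
  have [r1 r2] : rho <= N x /\ (Q + 1) `^ (b - a)^-1 <= N x.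
    by move: Rx; rewrite ge_max => /andP[].
  have N0 : 0 < N x by exact: lt_le_trans r1.
  apply: le_trans (far _ r1) _.
  apply: (@le_trans _ _ (K * (2 * N x) `^ (- a))); last first.
    rewrite ler_pM2l// !powRN lef_pV2 ?posrE ?powR_gt0 ?mulr_gt0//.
    by apply: ler_powR2r => //; exact: ltW.
  have h : Q <= N x `^ (b - a).
    apply: (@le_trans _ _ (Q + 1)); first lra.
    have -> : Q + 1 = ((Q + 1) `^ (b - a)^-1) `^ (b - a).
      by rewrite -powRrM mulVf ?powRr1//; [lra|rewrite subr_eq0 gt_eqF].
    by apply: ler_powR2r => //; [rewrite subr_ge0 ltW|exact: powR_ge0].
  rewrite (powRM _ (ler0n R 2) (ltW N0)).
  have -> : N x `^ (- a) = N x `^ (- b) * N x `^ (b - a) :> R.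
    by rewrite -powRD ?(gt_eqF N0) ?implybT//; congr (_ `^ _); lra.
  have h1 : C <= K * 2 `^ (- a) * N x `^ (b - a).
    have p2 : 0 < K * 2 `^ (- a) by rewrite mulr_gt0 ?powR_gt0.
    rewrite -ler_pdivrMl//; apply: le_trans h.
    by rewrite /Q powRN invfM invrK mulrC mulrA [X in _ <= X]mulrAC.
  have := powR_ge0 (N x) (- b); move: h1.
  move: (N x `^ (- b)) (N x `^ (b - a)) (2 `^ (- a)) => A B D h1 A0.
  have := ler_wpM2r A0 h1; lra.
apply: le_trans (bnd x) _.
rewrite powRN -ler_pdivrMr ?invr_gt0 ?powR_gt0// invrK.
have h : d `^ a <= K / (M + 1).
  have -> : K / (M + 1) = d0 `^ a.
    by rewrite /d0 -powRrM mulVf ?powRr1// ?gt_eqF// ltW.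
  by apply: ler_powR2r => //; exact: ltW.
apply: le_trans (ler_wpM2l M0 h) _.
by rewrite mulrCA ger_pMr// ler_pdivrMr//; lra.
Qed.

End powR_estimates.

(** * Functions vanishing at infinity and their extrema *)

Section vanishing_at_infinity.
Context {R : realType} {n : nat}.
Implicit Types (w : 'rV[R]_n -> R) (x y e : 'rV[R]_n).

Definition vanishing w := forall a, 0 < a ->
  exists rho : R, forall x, rho <= enorm x -> `|w x| < a.

(** Where [w] is at most the negative number [w x1] it stays away from 0, so this part of [A] is
    bounded, hence compact. *)
Lemma vanishing_min w (A : set 'rV[R]_n) x1 : continuous w -> vanishing w ->
  closed A -> A x1 -> w x1 < 0 -> exists2 x, A x & forall y, A y -> w x <= w y.
Proof.
move=> cw vw clA Ax1 wx1.
pose K := A `&` w @^-1` `]-oo, w x1]%classic.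
have clK : closed K.
  apply: closedI => //; apply: preimage_closed; last exact: interval_closed.
  by move=> x _; exact: cw.
have wx0 : 0 < - w x1 by rewrite oppr_gt0.
have [rho Hrho] := vw _ wx0.
have bK : bounded_set K.
  exists rho; split; first exact: num_real.
  move=> M rhoM x [_ /=]; rewrite in_itv/= => wx.
  apply: le_trans (ltW rhoM); apply: le_trans (normr_le_enorm x) _.
  rewrite leNgt; apply/negP => /ltW /Hrho.
  by rewrite ltr_norml => /andP[]; lra.
have cK : compact K by exact: bounded_closed_compact.
have K0 : K !=set0 by exists x1; split => //=; rewrite in_itv/=.
have [x xK xmin] := EVT_min_rV K0 cK (continuous_subspaceT cw).
move: xK; rewrite inE => -[Ax /=]; rewrite in_itv/= => wx.
exists x => // y Ay; have [wy|wy] := leP (w y) (w x1).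
  by apply: xmin; rewrite inE; split => //=; rewrite in_itv.
exact: le_trans wx (ltW wy).
Qed.

Lemma enorm_refl_ge_sub e l x : dot e e = 1 ->
  enorm x - 2 * `|l| <= enorm (refl e l x).
Proof.
move=> e1; have h := enormD (refl e l x) (- ((2 * l) *: e)).
move: h; rewrite {1}(reflE0 e l x) addrK enormN enormZ.
have -> : enorm e = 1 by rewrite enormE e1 sqrtr1.
have -> : enorm (refl e 0 x) = enorm x.
  by have := enorm_refl e1 0 x 0; rewrite refl0_0 !subr0.
by rewrite mulr1 normrM ger0_norm//; lra.
Qed.

Lemma vanishing_refl_diff w e l : dot e e = 1 -> vanishing w ->
  vanishing (refl_diff w e l).
Proof.
move=> e1 vw a a0; have a20 : 0 < a / 2 by rewrite divr_gt0.
have [rho H] := vw _ a20.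
exists (Num.max rho (rho + 2 * `|l|)) => x; rewrite ge_max => /andP[x1 x2].
have h1 := H x x1; have h2 : `|w (refl e l x)| < a / 2.
  by apply: H; have := enorm_refl_ge_sub l x e1; lra.
by apply: le_lt_trans (ler_normB _ _) _; move: h1 h2; rewrite /refl_diff; lra.
Qed.

Lemma decays_like_vanishing w (gamma : R) : 0 < gamma -> decays_like w gamma ->
  vanishing w.
Proof.
move=> g0 [c [C [rho [c0 cC rho0 H]]]] a a0.
have C0 : 0 < C by exact: lt_le_trans cC.
pose t := (2 * C / a) `^ gamma^-1.
exists (Num.max rho t) => x; rewrite ge_max => /andP[x1 x2].
have N0 : 0 < enorm x by exact: lt_le_trans x1.
have [w1 w2] := andP (H x x1).
have p0 : 0 <= enorm x `^ (- gamma) by exact: powR_ge0.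
rewrite ger0_norm; last by apply: le_trans w1; rewrite mulr_ge0// ltW.
apply: le_lt_trans w2 _.
have h : 2 * C / a <= enorm x `^ gamma.
  have -> : 2 * C / a = t `^ gamma.
    by rewrite /t -powRrM mulVf ?powRr1 ?gt_eqF// divr_ge0 ?mulr_ge0// ltW.
  by apply: ler_powR2r => //; [exact: ltW|exact: powR_ge0].
rewrite powRN ltr_pdivrMr ?powR_gt0//.
move: h; rewrite ler_pdivrMr// mulrC; lra.
Qed.

End vanishing_at_infinity.

(** * The coupled system *)

Section coupled_minimum.
Context {R : realType}.

(** Split [va * a^p - vb * b^p] into [va * (a^p - b^p)] and [(va - vb) * b^p]. By [powR_sub_le] the
    first part is at most half of [K * (a - b) * D] and is absorbed; the second is at most
    [K / 4 * D] times the positive part of [va - vb], and dividing by the remaining half gives the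
    factor 1/2. The term in [w] has the favourable sign. *)
Lemma coupled_min_first (p w a b va vb K D X : R) : 1 < p -> 0 <= w ->
  0 < a -> 0 < b -> b < a -> 0 < va -> 0 < K -> 0 < D ->
  X + w * (b - a) = vb * b `^ p - va * a `^ p -> X <= K * (b - a) * D ->
  p * va * a `^ (p - 1) <= K / 2 * D -> a `^ p <= K / 4 * D ->
  a - b <= 2^-1 * Num.max 0 (va - vb).
Proof.
move=> p1 w0 a0 b0 ba va0 K0 D0 eX X_le h1 h2.
pose m := Num.max 0 (va - vb).
have m0 : 0 <= m by rewrite le_max lexx.
have mv : va - vb <= m by rewrite le_max lexx orbT.
have conv := powR_sub_le p1 b0 (ltW ba).
have bp : b `^ p <= a `^ p by apply: ler_powR2r; lra.
have bp0 := powR_ge0 b p.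
have ap0 := powR_ge0 a (p - 1).
have i1 : (va - vb) * b `^ p <= m * b `^ p by rewrite ler_wpM2r.
have i2 : m * b `^ p <= m * a `^ p by rewrite ler_wpM2l.
have i3 : m * a `^ p <= m * (K / 4 * D) by rewrite ler_wpM2l.
have i4 : va * (a `^ p - b `^ p) <= va * (p * a `^ (p - 1) * (a - b)).
  by rewrite ler_wpM2l// ltW.
have ab0 : 0 <= a - b by lra.
have i5 : p * va * a `^ (p - 1) * (a - b) <= K / 2 * D * (a - b).
  by rewrite ler_wpM2r.
have i6 : 0 <= w * (a - b) by rewrite mulr_ge0.
have i7 : K * D * (a - b) <= K * D * (2^-1 * m).
  move: eX X_le i1 i2 i3 i4 i5 i6; clearbody m.
  move: (b `^ p) (a `^ p) (a `^ (p - 1)) => Bp Ap Aq.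
  lra.
by rewrite ler_pM2l ?mulr_gt0 in i7.
Qed.

(** The right-hand side of the second equation does not contain [v]: nothing is absorbed, and the
    bound [K / 2] gives the factor 1/2 directly. *)
Lemma coupled_min_second (q a b va vb K D X : R) : 1 < q ->
  0 < a -> 0 < b -> vb < va -> 0 < K -> 0 < D ->
  X = b `^ q - a `^ q -> X <= K * (vb - va) * D ->
  q * a `^ (q - 1) <= K / 2 * D ->
  va - vb <= 2^-1 * Num.max 0 (a - b).
Proof.
move=> q1 a0 b0 vba K0 D0 eX X_le h1.
pose m := Num.max 0 (a - b).
have m0 : 0 <= m by rewrite le_max lexx.
have i1 : a `^ q - b `^ q <= q * a `^ (q - 1) * m.
  have [ab|ba] := leP a b.
    have : a `^ q <= b `^ q by apply: ler_powR2r; lra.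
    have : 0 <= q * a `^ (q - 1) * m.
      by apply: mulr_ge0 => //; apply: mulr_ge0; [lra|exact: powR_ge0].
    by lra.
  have -> : m = a - b by apply/max_idPr; lra.
  exact: powR_sub_le q1 b0 (ltW ba).
have i2 : q * a `^ (q - 1) * m <= K / 2 * D * m by rewrite ler_wpM2r.
have i7 : K * D * (va - vb) <= K * D * (2^-1 * m).
  move: eX X_le i1 i2; clearbody m.
  move: (b `^ q) (a `^ q) (a `^ (q - 1)) => Bp Ap Aq.
  lra.
by rewrite ler_pM2l ?mulr_gt0 in i7.
Qed.

Lemma sub_affine_eqs (A1 A2 w b a B1 B2 : R) : A1 + w * b = B1 ->
  A2 + w * a = B2 -> A1 - A2 + w * (b - a) = B1 - B2.
Proof. by move=> <- <-; lra. Qed.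

Lemma sub_affine_eqs_eq (A1 A2 w b a vb va k : R) : b = a ->
  A1 + w * b = vb * b `^ k -> A2 + w * a = va * a `^ k ->
  A1 - A2 = (vb - va) * a `^ k.
Proof. by move=> -> h1 h2; rewrite mulrBl; move: h1 h2; lra. Qed.

Lemma powR_le_cancel (q a b : R) : 0 < q -> 0 < a -> 0 < b ->
  b `^ q <= a `^ q -> b <= a.
Proof.
move=> q0 a0 b0 h; rewrite leNgt; apply/negP => ab; move: h; rewrite leNgt.
by rewrite gt0_ltr_powR ?nnegrE// ltW.
Qed.

Lemma sub_eqs (A1 A2 B1 B2 : R) : A1 = B1 -> A2 = B2 -> A1 - A2 = B1 - B2.
Proof. by move=> -> ->. Qed.

(** [a] and [b] stand for [- U] and [- V] at their own minima, [a'] and [b'] for their values at the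
    minimum of the other function; the bounds combine to [a <= a / 4]. *)
Lemma half_of_each_other (a b a' b' : R) : 0 < a ->
  a <= 2^-1 * Num.max 0 b' -> b' <= b -> 0 < b -> b <= 2^-1 * Num.max 0 a' ->
  a' <= a -> False.
Proof.
move=> a0 h1 h2 b0 h3 h4.
have : Num.max 0 b' <= b by rewrite ge_max (ltW b0).
have : Num.max 0 a' <= a by rewrite ge_max (ltW a0).
lra.
Qed.

End coupled_minimum.

Section vanishing_extrema.
Context {R : realType} {n : nat}.
Variable w : 'rV[R]_n -> R.
Hypotheses (w_cont : continuous w) (w_van : vanishing w).

Lemma vanishing_max x1 : 0 < w x1 -> exists x0, forall y, w y <= w x0.
Proof.
move=> wx1; pose w' x := - w x.
have cw' : continuous w'.
  move=> x; rewrite (_ : w' = fun x => 0 - w x); last first.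
    by apply/funext => y; rewrite sub0r.
  by apply: continuous_subR; [exact: cst_continuous|exact: w_cont].
have vw' : vanishing w'.
  move=> a a0; have [rho H] := w_van a0; exists rho => x /H.
  by rewrite /w' normrN.
have w'x1 : w' x1 < 0 by rewrite oppr_lt0.
have [x0 _ H] := vanishing_min cw' vw' closedT (I : setT x1) w'x1.
by exists x0 => y; have := H y I; rewrite lerN2.
Qed.

(** The minimum over the closed half-space is negative, so it cannot lie on the plane, where the
    difference vanishes. *)
Lemma refl_diff_neg_min e l x1 : dot e e = 1 -> dot e x1 <= l ->
  refl_diff w e l x1 < 0 -> exists x, [/\ dot e x < l, refl_diff w e l x < 0 &
    forall y, dot e y <= l -> refl_diff w e l x <= refl_diff w e l y].
Proof.
move=> e1 xl wx1; pose A := dot e @^-1` `]-oo, l]%classic.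
have AE y : A y = (dot e y <= l) :> Prop by rewrite /A /= in_itv.
have clA : closed A.
  apply: preimage_closed; last exact: interval_closed.
  by move=> x _; exact: continuous_dot.
have Ax1 : A x1 by rewrite AE.
have [x Ax Hx] := vanishing_min (@continuous_refl_diff R n w w_cont e l e1)
  (@vanishing_refl_diff R n w e l e1 w_van) clA Ax1 wx1.
have Ux : refl_diff w e l x < 0 by exact: le_lt_trans (Hx _ Ax1) wx1.
exists x; split; [|exact: Ux|by move=> y yl; apply: Hx; rewrite AE].
have xl' : dot e x <= l by move: Ax; rewrite AE.
rewrite lt_neqAle xl' andbT.
by apply/eqP => /(refl_diff_plane w) Ux0; rewrite Ux0 ltxx in Ux.
Qed.

End vanishing_extrema.

(** * Domination below a plane for solutions of the system *)

Section moving_planes.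
Context {R : realType} {n : nat}.
Variables (alpha s omega p q : R) (F : R -> R) (c0 gamma tau : R).
Variables (u v : 'rV[R]_n -> R).
Implicit Types (x y e : 'rV[R]_n) (l m : R).
Hypotheses (n1 : (1 <= n)%N) (alpha0 : 0 < alpha) (alpha2 : alpha < 2).
Hypotheses (s0 : 0 < s) (s1 : s < 1) (omega0 : 0 <= omega).
Hypotheses (p1 : 1 < p) (q1 : 1 < q) (c0_gt0 : 0 < c0).
Hypothesis F_mono : forall a b, a <= b -> c0 * (b - a) <= F b - F a.
Hypotheses (F_cont : continuous F) (u_cont : continuous u) (v_cont : continuous v).
Hypothesis uv_sol : positive_solution F alpha s omega p q u v.
Hypotheses (gamma0 : 0 < gamma) (tau0 : 0 < tau).
Hypotheses (u_decay : decays_like u gamma) (v_decay : decays_like v tau).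
Hypotheses (exp1 : alpha < gamma * (p - 1) + tau) (exp2 : alpha < p * gamma).
Hypothesis exp3 : 2 * s < gamma * (q - 1).

Lemma u_gt0 x : 0 < u x. Proof. by have [] := uv_sol x. Qed.
Lemma v_gt0 x : 0 < v x. Proof. by have [] := uv_sol x. Qed.

Lemma u_pv_defined x : Falpha_defined F alpha u x.
Proof. by have [[]] := uv_sol x. Qed.

Lemma v_pv_defined x : Falpha_defined id (2 * s) v x.
Proof. by have [_ []] := uv_sol x. Qed.

Local Notation Cu := (Cnalpha n alpha).
Local Notation Cv := (Cnalpha n (2 * s)).
Local Notation PVu := (PV F alpha u).
Local Notation PVv := (PV id (2 * s) v).

Lemma eq_u x : Cu * PVu x + omega * u x = v x * u x `^ p.
Proof. by have [[_ ?]] := uv_sol x. Qed.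

Lemma eq_v x : Cv * PVv x = u x `^ q.
Proof. by have [_ [_ ?]] := uv_sol x. Qed.

Lemma Cu_gt0 : 0 < Cu. Proof. exact: Cnalpha_gt0. Qed.

Lemma s20 : 0 < 2 * s. Proof. by rewrite mulr_gt0. Qed.

Lemma Cv_gt0 : 0 < Cv.
Proof. by apply: Cnalpha_gt0 => //; [exact: s20|rewrite gtr_pMr]. Qed.

(** The factor of [U x * d^(-alpha)] in [PV_diff_min] once the normalizing constant is restored; for
    [v] the slope constant is 1. *)
Definition coer_u : R := Cu * (c0 * @cube_const R n alpha).
Definition coer_v : R := Cv * @cube_const R n (2 * s).

Lemma coer_u_gt0 : 0 < coer_u.
Proof. by rewrite mulr_gt0 ?Cu_gt0// mulr_gt0// cube_const_gt0. Qed.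

Lemma coer_v_gt0 : 0 < coer_v.
Proof. by rewrite mulr_gt0 ?Cv_gt0// cube_const_gt0. Qed.

Lemma q_gt0 : 0 < q. Proof. exact: lt_trans q1. Qed.
Lemma q_ge0 : 0 <= q. Proof. exact: ltW q_gt0. Qed.

Lemma id_mono (a b : R) : a <= b -> 1 * (b - a) <= id b - id a.
Proof. by rewrite mul1r. Qed.

Lemma id_cont : continuous (id : R -> R).
Proof. by move=> x; exact: cvg_id. Qed.

(** The first and third coefficients come from increments of [u^p] and [u^q], the second multiplies
    the difference of [v]. The fractions are those of [coupled_min_first] and
    [coupled_min_second]. *)
Definition absorbed x (d : R) : Prop :=
  [/\ p * v x * u x `^ (p - 1) <= coer_u / 2 * d `^ (- alpha),
      u x `^ p <= coer_u / 4 * d `^ (- alpha) &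
      q * u x `^ (q - 1) <= coer_v / 2 * d `^ (- (2 * s))].

Section fixed_plane.
Variables (e : 'rV[R]_n) (l : R).
Hypothesis e1 : dot e e = 1.
Local Notation r := (refl e l).
Local Notation U := (refl_diff u e l).
Local Notation V := (refl_diff v e l).

Lemma min_u x : dot e x < l -> U x < 0 ->
  (forall y, dot e y <= l -> U x <= U y) -> absorbed x (l - dot e x) ->
  - U x <= 2^-1 * Num.max 0 (- V x).
Proof.
move=> xl Ux Umin [g1 g2 _].
have d0 : 0 < l - dot e x by rewrite subr_gt0.
have h := PV_diff_min n1 alpha0 c0_gt0 F_mono F_cont u_cont u_pv_defined e1
  xl (ltW Ux) Umin.
have D0 : 0 < (l - dot e x) `^ (- alpha) by exact: powR_gt0.
have uu : u (r x) < u x by rewrite -subr_lt0.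
have X_le : Cu * (PVu (r x) - PVu x) <=
    coer_u * (u (r x) - u x) * (l - dot e x) `^ (- alpha).
  have := ler_wpM2l (ltW Cu_gt0) h; rewrite /coer_u /refl_diff.
  by rewrite !mulrA.
have eX : Cu * (PVu (r x) - PVu x) + omega * (u (r x) - u x) =
    v (r x) * u (r x) `^ p - v x * u x `^ p.
  by rewrite mulrBr; exact: sub_affine_eqs (eq_u (r x)) (eq_u x).
rewrite /refl_diff !opprB.
exact: (coupled_min_first p1 omega0 (u_gt0 x) (u_gt0 (r x)) uu (v_gt0 x) coer_u_gt0
  D0 eX X_le g1 g2).
Qed.

Lemma min_v x : dot e x < l -> V x < 0 ->
  (forall y, dot e y <= l -> V x <= V y) -> absorbed x (l - dot e x) ->
  - V x <= 2^-1 * Num.max 0 (- U x).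
Proof.
move=> xl Vx Vmin [_ _ g3].
have d0 : 0 < l - dot e x by rewrite subr_gt0.
have h := PV_diff_min n1 s20 ltr01 id_mono id_cont v_cont v_pv_defined e1 xl (ltW Vx) Vmin.
have D0 : 0 < (l - dot e x) `^ (- (2 * s)) by exact: powR_gt0.
have vv : v (r x) < v x by rewrite -subr_lt0.
have X_le : Cv * (PVv (r x) - PVv x) <=
    coer_v * (v (r x) - v x) * (l - dot e x) `^ (- (2 * s)).
  have := ler_wpM2l (ltW Cv_gt0) h; rewrite /coer_v /refl_diff mul1r.
  by rewrite !mulrA.
have eX : Cv * (PVv (r x) - PVv x) = u (r x) `^ q - u x `^ q.
  by rewrite mulrBr; exact: sub_eqs (eq_v (r x)) (eq_v x).
rewrite /refl_diff !opprB.
exact: (coupled_min_second q1 (u_gt0 x) (u_gt0 (r x)) vv coer_v_gt0 D0 eX X_le g3).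
Qed.

Lemma u_vanishing : vanishing u. Proof. exact: decays_like_vanishing u_decay. Qed.
Lemma v_vanishing : vanishing v. Proof. exact: decays_like_vanishing v_decay. Qed.

Definition dominated : Prop := forall x, dot e x <= l -> 0 <= U x /\ 0 <= V x.

(** The minima of [U] and [V] may lie at different points. A negative minimum of [U] forces [V] to
    be negative at that point, hence [V] has a negative minimum too, and each is then bounded by
    half the other. A negative minimum of [V] likewise forces a negative value of [U]. *)
Lemma dominated_of_absorbed :
  (forall x, dot e x < l -> U x < 0 \/ V x < 0 -> absorbed x (l - dot e x)) ->
  dominated.
Proof.
move=> H.
have impU x1 : dot e x1 <= l -> U x1 < 0 -> False.
  move=> xl Ux1; have [x [xl' Ux Umin]] := refl_diff_neg_min u_cont u_vanishing e1 xl Ux1.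
  have h1 := min_u xl' Ux Umin (H x xl' (or_introl Ux)).
  have Vx : V x < 0.
    rewrite ltNge; apply/negP => Vx; move: h1.
    rewrite (_ : Num.max 0 _ = 0); last by apply/max_idPl; rewrite oppr_le0.
    by rewrite mulr0 oppr_le0 leNgt Ux.
  have [y [yl Vy Vmin]] := refl_diff_neg_min v_cont v_vanishing e1 (ltW xl') Vx.
  have h2 := min_v yl Vy Vmin (H y yl (or_intror Vy)).
  apply: (half_of_each_other _ h1 _ _ h2).
  - by rewrite oppr_gt0.
  - by rewrite lerN2; exact: Vmin (ltW xl').
  - by rewrite oppr_gt0.
  - by rewrite lerN2; exact: Umin (ltW yl).
have impV x1 : dot e x1 <= l -> V x1 < 0 -> False.
  move=> xl Vx1; have [x [xl' Vx Vmin]] := refl_diff_neg_min v_cont v_vanishing e1 xl Vx1.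
  have h1 := min_v xl' Vx Vmin (H x xl' (or_intror Vx)).
  have [Ux|Ux] := ltP (U x) 0; first exact: impU (ltW xl') Ux.
  move: h1; rewrite (_ : Num.max 0 _ = 0); last by apply/max_idPl; rewrite oppr_le0.
  by rewrite mulr0 oppr_le0 leNgt Vx.
by move=> x xl; split; rewrite leNgt; apply/negP; [exact: impU|exact: impV].
Qed.

Lemma PV_u_diff x : U x = 0 -> Cu * (PVu (r x) - PVu x) = V x * u x `^ p.
Proof.
move=> Ux; rewrite mulrBr.
exact: sub_affine_eqs_eq (subr0_eq Ux) (eq_u (r x)) (eq_u x).
Qed.

Lemma PV_v_diff x : Cv * (PVv (r x) - PVv x) = u (r x) `^ q - u x `^ q.
Proof. by rewrite mulrBr; exact: sub_eqs (eq_v (r x)) (eq_v x). Qed.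

Lemma symmetric_of_below : (forall x, dot e x < l -> U x = 0 /\ V x = 0) ->
  forall x, U x = 0 /\ V x = 0.
Proof.
move=> H x; have [xl|xl|xl] := ltgtP (dot e x) l.
- exact: H.
- have [h1 h2] : U (r x) = 0 /\ V (r x) = 0.
    by apply: H; rewrite (dot_refl e1); lra.
  by split; [move: h1|move: h2]; rewrite (refl_diff_refl _ _ e1) => /eqP;
    rewrite oppr_eq0 => /eqP.
- by rewrite !(refl_diff_plane _ xl).
Qed.

(** At a zero of [U] the equations make the difference of the operators equal to [V x * u x ^ p],
    which is nonnegative, whereas a positive value of [U] below the plane would make it negative.
    Once [U] vanishes below the plane, the same identity at every point there forces [V <= 0]. *)
Lemma symmetric_of_touching_u x : dominated -> dot e x < l -> U x = 0 ->
  forall y, U y = 0 /\ V y = 0.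
Proof.
move=> dom xl Ux; apply: symmetric_of_below.
have Uge y : dot e y <= l -> 0 <= U y by move=> /dom[].
have below y : dot e y < l -> U y = 0.
  move=> yl; apply/eqP; rewrite eq_le (Uge _ (ltW yl)) andbT leNgt; apply/negP => Uy.
  have h := PV_diff_strong n1 alpha0 c0_gt0 F_mono F_cont u_cont
    u_pv_defined e1 xl Ux Uge yl Uy.
  have h1 : Cu * (PVu (r x) - PVu x) < 0 by rewrite pmulr_rlt0 ?Cu_gt0.
  rewrite (PV_u_diff Ux) in h1; have [_ Vx] := dom x (ltW xl).
  by move: h1; rewrite ltNge mulr_ge0 ?powR_ge0.
move=> y yl; split; first exact: below.
have [_ Vy] := dom y (ltW yl); apply/eqP; rewrite eq_le Vy andbT.
have h := PV_diff_touching n1 alpha0 c0_gt0 F_mono F_cont u_cont u_pv_defined e1 yl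
  (below y yl) Uge.
have h1 : Cu * (PVu (r y) - PVu y) <= 0 by rewrite pmulr_rle0 ?Cu_gt0.
rewrite (PV_u_diff (below y yl)) in h1.
by rewrite pmulr_lle0 ?powR_gt0 ?u_gt0 in h1.
Qed.

(** At a zero of [V] the second equation yields [u (r x) ^ q <= u x ^ q], so [U] vanishes at [x] as
    well and the case of [U] applies. *)
Lemma symmetric_of_touching_v x : dominated -> dot e x < l -> V x = 0 ->
  forall y, U y = 0 /\ V y = 0.
Proof.
move=> dom xl Vx; have Vge y : dot e y <= l -> 0 <= V y by move=> /dom[].
have below y : dot e y < l -> V y = 0.
  move=> yl; apply/eqP; rewrite eq_le (Vge _ (ltW yl)) andbT leNgt; apply/negP => Vy.
  have h := PV_diff_strong n1 s20 ltr01 id_mono id_cont v_cont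
    v_pv_defined e1 xl Vx Vge yl Vy.
  have h1 : Cv * (PVv (r x) - PVv x) < 0 by rewrite pmulr_rlt0 ?Cv_gt0.
  have [Ux _] := dom x (ltW xl); move: h1; rewrite PV_v_diff subr_lt0 ltNge => /negP.
  apply; apply: ler_powR2r; [exact: q_ge0|exact: ltW (u_gt0 x)|].
  by rewrite -subr_ge0; exact: Ux.
have h := PV_diff_touching n1 s20 ltr01 id_mono id_cont v_cont v_pv_defined e1 xl Vx Vge.
have h1 : Cv * (PVv (r x) - PVv x) <= 0 by rewrite pmulr_rle0 ?Cv_gt0.
rewrite PV_v_diff subr_le0 in h1.
apply: (symmetric_of_touching_u dom xl).
have [Ux _] := dom x (ltW xl); apply/eqP; rewrite eq_le Ux andbT subr_le0.
exact: powR_le_cancel q_gt0 (u_gt0 x) (u_gt0 (r x)) h1.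
Qed.

Lemma dominated_dichotomy : dominated ->
  (forall x, dot e x < l -> 0 < U x /\ 0 < V x) \/ (forall x, U x = 0 /\ V x = 0).
Proof.
move=> dom; have [|nsym] := pselect (forall x, U x = 0 /\ V x = 0); first by right.
left => x xl; have [Ux Vx] := dom x (ltW xl).
split; rewrite lt_neqAle ?Ux ?Vx andbT; apply/eqP => /esym h; apply: nsym.
  exact: symmetric_of_touching_u dom xl h.
exact: symmetric_of_touching_v dom xl h.
Qed.

End fixed_plane.

Lemma powR_decay (w : 'rV[R]_n -> R) (g C k : R) x : 0 < k -> 0 < w x -> 0 < C ->
  w x <= C * enorm x `^ (- g) -> w x `^ k <= C `^ k * enorm x `^ (- (g * k)).
Proof.
move=> k0 w0 C0 h; apply: le_trans (ler_powR2r (ltW k0) (ltW w0) h) _.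
by rewrite (powRM _ (ltW C0) (powR_ge0 _ _)) -powRrM mulNr.
Qed.

(** The constants are uniform in the direction and in all planes up to [L], because only the decay
    of [u] and [v] and their maxima enter. *)
Lemma absorbed_region (L : R) : exists R0 d0 : R, [/\ 0 < R0, 0 < d0 &
  forall e l x, dot e e = 1 -> l <= L -> dot e x < l ->
    R0 <= enorm x \/ l - dot e x <= d0 -> absorbed x (l - dot e x)].
Proof.
have [cu [Cu' [ru [cu0 cuC ru0 Hu]]]] := u_decay.
have [cv [Cv' [rv [cv0 cvC rv0 Hv]]]] := v_decay.
have Cu0 : 0 < Cu' by exact: lt_le_trans cuC.
have Cv0 : 0 < Cv' by exact: lt_le_trans cvC.
have [xu Mu] := vanishing_max u_cont u_vanishing (u_gt0 0).
have [xv Mv] := vanishing_max v_cont v_vanishing (v_gt0 0).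
have p10 : 0 < p - 1 by rewrite subr_gt0.
have q10 : 0 < q - 1 by rewrite subr_gt0.
have p00 : 0 < p by exact: lt_trans p1.
have q00 := q_gt0.
have [K10 K20] := (coer_u_gt0, coer_v_gt0).
have K12 : 0 < coer_u / 2 by rewrite divr_gt0.
have K14 : 0 < coer_u / 4 by rewrite divr_gt0.
have K22 : 0 < coer_v / 2 by rewrite divr_gt0.
pose rho := Num.max ru rv.
have rho0 : 0 < rho by rewrite lt_max ru0.
have ruv x : rho <= enorm x -> ru <= enorm x /\ rv <= enorm x.
  by rewrite ge_max => /andP.
have far1 x : rho <= enorm x -> p * v x * u x `^ (p - 1) <=
    (p * Cv' * Cu' `^ (p - 1)) * enorm x `^ (- (gamma * (p - 1) + tau)).
  move=> /[dup] rx /ruv[/Hu/andP[_ hu] /Hv/andP[_ hv]].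
  have h := powR_decay p10 (u_gt0 x) Cu0 hu.
  have N0 : 0 < enorm x by exact: lt_le_trans rx.
  have -> : enorm x `^ (- (gamma * (p - 1) + tau)) =
      enorm x `^ (- tau) * enorm x `^ (- (gamma * (p - 1))) :> R.
    rewrite -powRD ?(gt_eqF N0) ?implybT//; congr (_ `^ _).
    by rewrite opprD addrC.
  rewrite mulrACA -mulrA [X in _ <= X](_ : _ =
    p * ((Cv' * enorm x `^ (- tau)) * (Cu' `^ (p - 1) * enorm x `^ (- (gamma * (p - 1)))))).
    rewrite ler_pM2l//; apply: ler_pM => //; [exact/ltW/v_gt0|exact: powR_ge0].
  by rewrite -!mulrA.
have bnd1 x : p * v x * u x `^ (p - 1) <= p * v xv * u xu `^ (p - 1).
  apply: ler_pM.
  - by rewrite mulr_ge0 ?ltW ?v_gt0.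
  - exact: powR_ge0.
  - by rewrite ler_pM2l.
  - by apply: ler_powR2r; [exact: ltW|exact/ltW/u_gt0|exact: Mu].
have far2 x : rho <= enorm x -> u x `^ p <= Cu' `^ p * enorm x `^ (- (p * gamma)).
  move=> /ruv[/Hu/andP[_ hu] _].
  by have := powR_decay p00 (u_gt0 x) Cu0 hu; rewrite [gamma * p]mulrC.
have bnd2 x : u x `^ p <= u xu `^ p.
  by apply: ler_powR2r; [exact: ltW|exact/ltW/u_gt0|exact: Mu].
have far3 x : rho <= enorm x -> q * u x `^ (q - 1) <=
    (q * Cu' `^ (q - 1)) * enorm x `^ (- (gamma * (q - 1))).
  move=> /ruv[/Hu/andP[_ hu] _].
  have := powR_decay q10 (u_gt0 x) Cu0 hu.
  by rewrite -mulrA ler_pM2l.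
have bnd3 x : q * u x `^ (q - 1) <= q * u xu `^ (q - 1).
  rewrite ler_pM2l//.
  by apply: ler_powR2r; [exact: ltW|exact/ltW/u_gt0|exact: Mu].
have C1 : 0 <= p * Cv' * Cu' `^ (p - 1).
  by rewrite mulr_ge0 ?powR_ge0// mulr_ge0// ltW.
have C3 : 0 <= q * Cu' `^ (q - 1) by rewrite mulr_ge0 ?powR_ge0// ltW.
have M1 : 0 <= p * v xv * u xu `^ (p - 1).
  by rewrite mulr_ge0 ?powR_ge0// mulr_ge0 ?ltW ?v_gt0.
have M3 : 0 <= q * u xu `^ (q - 1) by rewrite mulr_ge0 ?powR_ge0// ltW.
have [R1 [d1 [R10 d10 H1]]] := absorb_far_or_near alpha0 exp1 K12 C1 rho0 M1 far1 bnd1.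
have [R2 [d2 [R20 d20 H2]]] := absorb_far_or_near alpha0 exp2 K14 (powR_ge0 Cu' p)
  rho0 (powR_ge0 (u xu) p) far2 bnd2.
have [R3 [d3 [R30 d30 H3]]] := absorb_far_or_near s20 exp3 K22 C3 rho0 M3 far3 bnd3.
exists (Num.max (Num.max R1 R2) (Num.max R3 `|L|)), (Num.min d1 (Num.min d2 d3)).
split; first by rewrite !lt_max R10.
  by rewrite !lt_min d10 d20 d30.
move=> e l x e1 lL xl reg.
have dpos : 0 < l - dot e x by rewrite subr_gt0.
(* Having [|L|] in the maximum defining [R0] keeps the distance to the plane below twice the norm of
   [x], as [absorb_far_or_near] requires. *)
have dN : `|L| <= enorm x -> l - dot e x <= 2 * enorm x.
  have := dot_le e x; have := ler_norm (- dot e x); have := ler_norm L.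
  have -> : enorm e = 1 by rewrite enormE e1 sqrtr1.
  by rewrite normrN mul1r; lra.
rewrite !ge_max !le_min in reg.
split.
- apply: H1 => //; case: reg 
    => [/andP[/andP[a1 a2] /andP[a3 a4]]|/andP[a1 _]]; last first.
    by right.
  by left; split => //; exact: dN.
- apply: H2 => //; case: reg 
    => [/andP[/andP[a1 a2] /andP[a3 a4]]|/and3P[_ a1 _]]; last first.
    by right.
  by left; split => //; exact: dN.
- apply: H3 => //; case: reg 
    => [/andP[/andP[a1 a2] /andP[a3 a4]]|/and3P[_ _ a1]]; last first.
    by right.
  by left; split => //; exact: dN.
Qed.

(** Leaves only a bounded set at distance more than [d0] from the plane to be checked, where
    compactness is available; elsewhere the absorption estimates suffice. *)
Lemma dominated_of_region (L : R) : exists R0 d0 : R, [/\ 0 < R0, 0 < d0 &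
  forall e l, dot e e = 1 -> l <= L ->
    (forall x, dot e x < l -> enorm x < R0 -> d0 < l - dot e x ->
      0 <= refl_diff u e l x /\ 0 <= refl_diff v e l x) -> dominated e l].
Proof.
have [R0 [d0 [R00 d00 H]]] := absorbed_region L; exists R0, d0; split => //.
move=> e l e1 lL Hin; apply: dominated_of_absorbed => // x xl neg.
apply: (H e l x e1 lL xl).
have [Rx|xR] := leP R0 (enorm x); first by left.
have [dl|ld] := leP (l - dot e x) d0; first by right.
have [Ux Vx] := Hin x xl xR ld.
by case: neg; rewrite ltNge ?Ux ?Vx.
Qed.

End moving_planes.

(** * Moving the plane *)

Section reflection_continuity.
Context {R : realType} {n : nat}.
Implicit Types (x y e : 'rV[R]_n) (l m : R) (w : 'rV[R]_n -> R).

Lemma enorm_reflB e l m x : dot e e = 1 ->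
  enorm (refl e l x - refl e m x) = 2 * `|l - m|.
Proof.
move=> e1; rewrite /refl opprD addrACA subrr add0r -scalerBl enormZ.
rewrite enormE e1 sqrtr1 mulr1 -mulrBr opprB addrA subrK normrM.
by rewrite ger0_norm.
Qed.

Lemma refl_opp e l x : refl (- e) l x = refl e (- l) x.
Proof.
by rewrite /refl dotNl scalerN -scaleNr; congr (_ + _ *: _); lra.
Qed.

Lemma refl_diff_jointly_continuous w e l x a : dot e e = 1 -> continuous w -> 0 < a ->
  exists2 b, 0 < b & forall y m, enorm (y - x) < b -> `|m - l| < b ->
    `|refl_diff w e l x - refl_diff w e m y| < a.
Proof.
move=> e1 cw a0; have a20 : 0 < a / 2 by rewrite divr_gt0.
have [b1 b10 H1] := near_eball ((continuous_distP w (refl e l x)).1 (cw _) _ a20).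
have [b2 b20 H2] := near_eball ((continuous_distP w x).1 (cw _) _ a20).
(* The mirror images are at most [|y - x| + 2 |m - l|] apart, hence the third of [b1]. *)
exists (Num.min (b1 / 3) b2); first by rewrite lt_min divr_gt0.
move=> y m; rewrite !lt_min => /andP[y1 y2] /andP[m1 m2].
have h2 := H2 y y2.
have h1 : `|w (refl e l x) - w (refl e m y)| < a / 2.
  apply: H1.
  have := enormD (refl e m y - refl e m x) (refl e m x - refl e l x).
  rewrite addrA subrK (enorm_refl e1) (enorm_reflB m l x e1).
  move: (enorm _) (enorm _) y1 m1 => A B; lra.
rewrite /refl_diff.
move: (w _) (w _) (w _) (w _) h1 h2 => A B C D.
rewrite !ltr_norml => /andP[h1 h2] /andP[h3 h4]; apply/andP; split; lra.
Qed.

Lemma refl_diff_pos_compact w e l (A : set 'rV[R]_n) : dot e e = 1 -> continuous w ->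
  compact A -> (forall x, A x -> 0 < refl_diff w e l x) ->
  exists2 b, 0 < b & forall m, `|m - l| < b -> forall x, A x -> 0 < refl_diff w e m x.
Proof.
move=> e1 cw cA Apos.
have /(compact_near_coveringP A).1 cov := cA.
have : \forall m \near l, A `<=` (fun x => 0 < refl_diff w e m x).
  have := cov R (nbhs l) (fun m x => 0 < refl_diff w e m x) (nbhs_filter l).
  apply => x Ax.
  have [b b0 Hb] := refl_diff_jointly_continuous l x e1 cw (Apos x Ax).
  exists ([set y | enorm (y - x) < b], [set m | `|m - l| < b]); [split|] => /=.
  - exact (near_enorm x b0).
  - by apply/nbhs_normP; exists b => // m /=; rewrite distrC.
  - move=> [y m] /= [yx ml]; have := Hb y m yx ml.
    by move: (refl_diff _ _ _ _) (refl_diff _ _ _ _) => s t; rewrite ltr_norml; lra.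
move=> /nbhs_normP[b /= b0 Hb]; exists b => // m ml x Ax.
by apply: (Hb m) => //=; rewrite distrC.
Qed.

End reflection_continuity.

(** * The limiting plane in each direction and radial symmetry *)

Section radial_symmetry.
Context {R : realType} {n : nat}.
Variables (u v : 'rV[R]_n -> R).
Implicit Types (x y e : 'rV[R]_n) (l m : R).
Hypotheses (u_cont : continuous u) (v_cont : continuous v).
Hypotheses (u_gt0 : forall x, 0 < u x).
Hypotheses (u_van : vanishing u).
Hypothesis region : forall L : R, exists R0 d0 : R, [/\ 0 < R0, 0 < d0 &
  forall e l, dot e e = 1 -> l <= L ->
    (forall x, dot e x < l -> enorm x < R0 -> d0 < l - dot e x ->
      0 <= refl_diff u e l x /\ 0 <= refl_diff v e l x) -> dominated u v e l].
Hypothesis dichotomy : forall e l, dot e e = 1 -> dominated u v e l ->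
  (forall x, dot e x < l -> 0 < refl_diff u e l x /\ 0 < refl_diff v e l x) \/
  (forall x, refl_diff u e l x = 0 /\ refl_diff v e l x = 0).

Definition symmetric_about e l : Prop :=
  forall x, refl_diff u e l x = 0 /\ refl_diff v e l x = 0.

(** Composing the reflections in two parallel planes of symmetry gives a translation: [u] would be
    periodic along [e], equal to [u 0 > 0] at points going to infinity, where it vanishes. *)
Lemma symmetric_unique_lt e l m : dot e e = 1 -> symmetric_about e l ->
  symmetric_about e m -> m < l -> False.
Proof.
move=> e1 sl sm ml.
have shift x : u (x + (2 * (l - m)) *: e) = u x.
  have h1 : u (refl e l (refl e m x)) = u (refl e m x) by apply: subr0_eq; exact: (sl _).1.
  have h2 : u (refl e m x) = u x by apply: subr0_eq; exact: (sm _).1.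
  rewrite -h2 -h1; congr u.
  have -> : refl e l (refl e m x) =
    refl e m x + (2 * (l - dot e (refl e m x))) *: e by [].
  rewrite (dot_refl e1) /refl -addrA -scalerDl; congr (_ + _ *: _); lra.
have shiftk (k : nat) : u ((k%:R * (2 * (l - m))) *: e) = u 0.
  elim: k => [|k IH]; first by rewrite mul0r scale0r.
  by rewrite -natr1 mulrDl mul1r scalerDl shift.
have [rho H] := u_van (u_gt0 0).
have lm0 : 0 < 2 * (l - m) by rewrite mulr_gt0// subr_gt0.
pose k := Num.bound (`|rho| / (2 * (l - m))).
have hk : `|rho| / (2 * (l - m)) < k%:R.
  by apply: archi_boundP; rewrite divr_ge0// ltW.
have kr : rho <= enorm ((k%:R * (2 * (l - m))) *: e).
  rewrite enormZ enormE e1 sqrtr1 mulr1 ger0_norm; last first.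
    by rewrite mulr_ge0// ltW.
  by rewrite ltr_pdivrMr// in hk; have := ler_norm rho; lra.
have := H _ kr; rewrite shiftk gtr0_norm// ltxx//.
Qed.

Lemma symmetric_unique e l m : dot e e = 1 -> symmetric_about e l ->
  symmetric_about e m -> l = m.
Proof.
move=> e1 sl sm; apply/eqP; rewrite eq_le !leNgt.
apply/andP; split; apply/negP.
  exact: symmetric_unique_lt e1 sl sm.
exact: symmetric_unique_lt e1 sm sl.
Qed.

Section direction.
Variable e : 'rV[R]_n.
Hypothesis e1 : dot e e = 1.

Let e_norm : enorm e = 1. Proof. by rewrite enormE e1 sqrtr1. Qed.

(** For [l <= - R0] the set left to be checked by [region] is empty. *)
Lemma dominated_far : exists l0, forall l, l <= l0 -> dominated u v e l.
Proof.
have [R0 [d0 [R00 d00 H]]] := region 0; exists (- R0) => l lR.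
apply: H => //; first by apply: le_trans lR _; rewrite oppr_le0 ltW.
move=> x xl xR; exfalso.
have := dot_le e x; have := ler_norm (- dot e x); rewrite normrN e_norm mul1r.
by move: lR xl xR; move: (dot e x) (enorm x) => s t; lra.
Qed.

(** Domination compares the origin with its mirror image [2 l e], where [u] is smaller than [u 0]
    once [l] is large. *)
Lemma dominated_bounded : exists B, forall l, dominated u v e l -> l <= B.
Proof.
have [rho H] :=
  u_van (u_gt0 0); exists `|rho| => l dom; rewrite leNgt; apply/negP => lB.
have l0 : 0 < l by exact: le_lt_trans lB.
have h0 : dot e 0 <= l by rewrite dotr0 ltW.
have [+ _] := dom 0 h0; rewrite /refl_diff subr_ge0.
have -> : refl e l 0 = (2 * l) *: e by rewrite /refl dotr0 subr0 add0r.
have : rho <= enorm ((2 * l) *: e).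
  rewrite enormZ e_norm mulr1 gtr0_norm ?mulr_gt0//.
  by have := ler_norm rho; lra.
by move=> /H; rewrite gtr0_norm// leNgt => ->.
Qed.

Lemma dominated_limit l0 : (forall l, l < l0 -> dominated u v e l) ->
  dominated u v e l0.
Proof.
move=> H.
have aux w : continuous w ->
    (forall l x, l < l0 -> dot e x <= l -> 0 <= refl_diff w e l x) ->
    forall x, dot e x <= l0 -> 0 <= refl_diff w e l0 x.
  move=> cw Hw x; rewrite le_eqVlt => /orP[/eqP xl|xl].
    by rewrite (refl_diff_plane w xl).
  rewrite leNgt; apply/negP => neg.
  have neg' : 0 < - refl_diff w e l0 x by rewrite oppr_gt0.
  have [b b0 Hb] := refl_diff_jointly_continuous l0 x e1 cw neg'.
  (* A plane strictly before [l0], close enough for continuity, that has not yet passed [x]. *)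
  pose m := Num.max (dot e x) (l0 - b / 2).
  have m1 : dot e x <= m by rewrite le_max lexx.
  have m2 : m < l0 by rewrite gt_max xl /=; lra.
  have m3 : l0 - b / 2 <= m by rewrite le_max lexx orbT.
  have h1 := Hw m x m2 m1.
  have : `|refl_diff w e l0 x - refl_diff w e m x| < - refl_diff w e l0 x.
    apply: Hb; first by rewrite subrr enorm0.
    by rewrite ltr0_norm ?subr_lt0//; lra.
  move: h1; move: (refl_diff _ _ _ _) (refl_diff _ _ _ _) => s t h1.
  by rewrite ltr_norml; lra.
move=> x xl; split.
  by apply: (aux u) => // l y ll yl; have [] := H l ll y yl.
by apply: (aux v) => // l y ll yl; have [] := H l ll y yl.
Qed.

Lemma dominated_extend l0 : (forall l, l <= l0 -> dominated u v e l) ->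
  (forall x, dot e x < l0 -> 0 < refl_diff u e l0 x /\ 0 < refl_diff v e l0 x) ->
  exists2 b, 0 < b & forall l, l < l0 + b -> dominated u v e l.
Proof.
move=> dom pos; have [R0 [d0 [R00 d00 H]]] := region (l0 + 1).
(* If the plane advances by less than [d0 / 2], every point farther than [d0] below the new plane is
   still at least [d0 / 2] below the old one, so the part left by [region] stays in [A]. A step of
   at most 1 respects the bound [l0 + 1]. *)
pose A := [set x | dot e x <= l0 - d0 / 2] `&` [set x | enorm x <= R0].
have cA : compact A.
  apply: bounded_closed_compact.
    exists R0; split; first exact: num_real.
    move=> M RM x [_ /= xR]; apply: le_trans (ltW RM).
    exact: le_trans (normr_le_enorm x) xR.
  apply: closedI.
    rewrite (_ : [set x | _] = dot e @^-1` `]-oo, l0 - d0 / 2]%classic).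
      apply: preimage_closed; last exact: interval_closed.
      by move=> x _; exact: continuous_dot.
    by apply/seteqP; split => x /=; rewrite in_itv.
  rewrite (_ : [set x | _] = @enorm R n @^-1` `]-oo, R0]%classic).
    apply: preimage_closed; last exact: interval_closed.
    by move=> x _; exact: continuous_enorm.
  by apply/seteqP; split => x /=; rewrite in_itv.
have Al x : A x -> dot e x < l0 by move=> [/= h _]; lra.
have [b1 b10 H1] :=
  refl_diff_pos_compact e1 u_cont cA (fun x Ax => (pos x (Al x Ax)).1).
have [b2 b20 H2] :=
  refl_diff_pos_compact e1 v_cont cA (fun x Ax => (pos x (Al x Ax)).2).
pose b := Num.min (Num.min b1 b2) (Num.min 1 (d0 / 2)).
exists b; first by rewrite !lt_min b10 b20 ltr01 divr_gt0.
move=> l; have [ll _|l0l lb] := leP l l0; first exact: dom.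
have [[c1 c2] [c3 c4]] : (l - l0 < b1 /\ l - l0 < b2) /\ (l - l0 < 1 /\ l - l0 < d0 / 2).
  have : l - l0 < b by rewrite ltrBlDl.
  by rewrite !lt_min => /andP[/andP[-> ->] /andP[-> ->]].
have nl (t : R) : l - l0 < t -> `|l - l0| < t by rewrite gtr0_norm// subr_gt0.
apply: H => //; first by lra.
move=> x xl xR dx; have Ax : A x by split => /=; [lra|exact: ltW].
by split; apply/ltW; [exact: H1 (nl _ c1) x Ax|exact: H2 (nl _ c2) x Ax].
Qed.

(** At the supremum of the admissible positions, strict positivity would let the plane advance
    further, so the dichotomy leaves only symmetry. *)
Lemma symmetric_exists : exists l, (forall m, m <= l -> dominated u v e m) /\
  symmetric_about e l.
Proof.
pose S := [set l | forall m, m <= l -> dominated u v e m].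
have [l1 Hl1] := dominated_far; have [B HB] := dominated_bounded.
have hS : has_sup S.
  split; first by exists l1.
  by exists B => l Sl; apply: HB; exact: Sl.
have below m : m < sup S -> dominated u v e m.
  move=> mS; have d0 : 0 < sup S - m by rewrite subr_gt0.
  have [l Sl lS] := sup_adherent d0 hS; apply: Sl; move: lS; lra.
have at_sup : forall m, m <= sup S -> dominated u v e m.
  move=> m; rewrite le_eqVlt => /orP[/eqP->|]; last exact: below.
  exact: dominated_limit below.
exists (sup S); split => //.
have [pos|//] := dichotomy e1 (at_sup _ (lexx _)).
have [b b0 Hb] := dominated_extend at_sup pos.
have : S (sup S + b / 2) by move=> m mb; apply: Hb; lra.
by move=> /(sup_ubound hS.2); lra.
Qed.

End direction.

(** Before the final plane the symmetric alternative is excluded by uniqueness of the plane of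
    symmetry. *)
Lemma strict_below e l m x : dot e e = 1 -> symmetric_about e l ->
  dominated u v e m -> m < l -> dot e x < m ->
  0 < refl_diff u e m x /\ 0 < refl_diff v e m x.
Proof.
move=> e1 sl dm ml xm; have [pos|sm] := dichotomy e1 dm; first exact: pos.
by have := symmetric_unique_lt e1 sl sm ml.
Qed.

(* Otherwise an intermediate plane would reflect [x0] to a larger value of [u]. *)
Lemma plane_le_max x0 e l : dot e e = 1 -> (forall y, u y <= u x0) ->
  symmetric_about e l -> (forall m, m <= l -> dominated u v e m) -> l <= dot e x0.
Proof.
move=> e1 xmax sl dom; rewrite leNgt; apply/negP => xl.
pose m := (dot e x0 + l) / 2.
have m1 : dot e x0 < m by rewrite /m; lra.
have m2 : m < l by rewrite /m; lra.
have [+ _] := strict_below e1 sl (dom m (ltW m2)) m2 m1.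
by rewrite /refl_diff subr_gt0 ltNge xmax.
Qed.

Lemma symmetric_opp e l : symmetric_about (- e) l -> symmetric_about e (- l).
Proof. by move=> H x; have := H x; rewrite /refl_diff !refl_opp. Qed.

(** Planes are moved in from both ends. By uniqueness the two final planes coincide, and
    [plane_le_max] places this plane on neither side of [x0]. *)
Lemma symmetric_center x0 e : dot e e = 1 -> (forall y, u y <= u x0) ->
  symmetric_about e (dot e x0) /\ forall m, m <= dot e x0 -> dominated u v e m.
Proof.
move=> e1 xmax; have e1' : dot (- e) (- e) = 1 by rewrite dotNl dotNr opprK.
have [l [dl sl]] := symmetric_exists e1.
have [l' [dl' sl']] := symmetric_exists e1'.
have h1 := plane_le_max e1 xmax sl dl.
have h2 := plane_le_max e1' xmax sl' dl'.
have h3 := symmetric_unique e1 sl (symmetric_opp sl').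
have lE : l = dot e x0 by apply/eqP; rewrite eq_le h1 h3 lerNr -dotNl.
by rewrite -lE.
Qed.

(** The point [y] on the reference ray is as far from [x0] as [x] is, so the perpendicular bisector
    of [x] and [y] passes through [x0], and reflecting in it exchanges them. *)
Lemma radial_of_symmetric (w : 'rV[R]_n -> R) x0 e0 : dot e0 e0 = 1 ->
  (forall e x, dot e e = 1 -> w (refl e (dot e x0) x) = w x) ->
  forall x, w x = w (x0 + enorm (x - x0) *: e0).
Proof.
move=> e01 sym x; set y := x0 + _; have [->//|xy] := eqVneq x y.
pose N := enorm (x - y); pose e := N^-1 *: (x - y).
have N0 : 0 < N by rewrite enorm_gt0// subr_eq0.
have NN : N * N = dot (x - y) (x - y) by rewrite -expr2 sqr_enorm.
have e1 : dot e e = 1.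
  by rewrite /e dotZl dotZr -NN mulKf ?gt_eqF// mulVf ?gt_eqF.
have yx0 : dot (y - x0) (y - x0) = dot (x - x0) (x - x0).
  by rewrite /y addrAC subrr add0r dotZl dotZr e01 mulr1 -expr2 sqr_enorm.
(* This identity, a consequence of the equal distances to [x0], makes the reflection add exactly
   [- (x - y)] to [x]. *)
have key : 2 * dot (x - y) (x0 - x) = - (N * N).
  rewrite NN; have -> : x - y = (x - x0) - (y - x0) by rewrite opprB addrA subrK.
  have -> : x0 - x = - (x - x0) by rewrite opprB.
  move: yx0; move: (y - x0) (x - x0) => a b h.
  by rewrite !(dotDl, dotDr, dotNl, dotNr) h (dotC a b); lra.
rewrite -(sym e x e1); congr w.
rewrite /refl -dotNr -dotDr /e dotZl scalerA.
have -> : 2 * (N^-1 * dot (x - y) (x0 - x)) * N^-1 = -1.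
  by rewrite [2 * _]mulrCA key mulrN mulKf ?gt_eqF// mulNr mulfV// gt_eqF.
by rewrite scaleN1r opprB addrC subrK.
Qed.

Lemma radially_decreasing_exists : (1 <= n)%N ->
  exists x0, radially_decreasing u x0 /\ radially_decreasing v x0.
Proof.
move=> n1; have [x0 xmax] := vanishing_max u_cont u_van (u_gt0 0).
pose i0 := Ordinal n1; pose e0 : 'rV[R]_n := delta_mx ord0 i0.
have e01 : dot e0 e0 = 1.
  rewrite /dot (bigD1 i0)//= big1 ?addr0 => [|i ii0].
    by rewrite !mxE !eqxx mulr1.
  by rewrite !mxE (negbTE ii0) andbF mulr0.
have e01' : dot (- e0) (- e0) = 1 by rewrite dotNl dotNr opprK.
have [s1 d1] := symmetric_center e01' xmax.
have mono t1 t2 : 0 <= t1 -> t1 < t2 ->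
    u (x0 + t2 *: e0) < u (x0 + t1 *: e0) /\ v (x0 + t2 *: e0) < v (x0 + t1 *: e0).
  move=> t10 t12; pose x := x0 + t2 *: e0.
  (* The plane halfway between the two points, whose reflection takes the outer one to the inner
     one. The normal is [- e0] so that the outer point lies below the plane. *)
  pose m := dot (- e0) x0 - (t1 + t2) / 2.
  have ex : dot (- e0) x = dot (- e0) x0 - t2.
    by rewrite /x dotDr dotZr [dot _ e0]dotNl e01; lra.
  have m1 : m < dot (- e0) x0 by rewrite /m; lra.
  have m2 : dot (- e0) x < m by rewrite ex /m; lra.
  have := strict_below e01' s1 (d1 m (ltW m1)) m1 m2.
  rewrite /refl_diff !subr_gt0.
  have -> : refl (- e0) m x = x0 + t1 *: e0.
    rewrite /refl ex /m /x -addrA scalerN -scaleNr -scalerDl.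
    by congr (_ + _ *: _); lra.
  by [].
exists x0; split.
- exists (fun t => u (x0 + t *: e0)); last by move=> t1 t2 ? ?; have [] := mono t1 t2.
  apply: (radial_of_symmetric e01) => e x e1; apply: subr0_eq.
  by have [sym _] := symmetric_center e1 xmax; have [] := sym x.
- exists (fun t => v (x0 + t *: e0)); last by move=> t1 t2 ? ?; have [] := mono t1 t2.
  apply: (radial_of_symmetric e01) => e x e1; apply: subr0_eq.
  by have [sym _] := symmetric_center e1 xmax; have [] := sym x.
Qed.

End radial_symmetry.

Lemma locally_lipschitz_continuous (R : realType) (F : R -> R) :
  locally_lipschitz F -> continuous F.
Proof.
move=> lF t; have [A At [M [_ HM]]] := lF t.
pose K := Num.max 0 M + 1.
have K0 : 0 < K by rewrite ltr_wpDl// le_max lexx.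
apply/cvgrPdist_lt => a a0; near=> y.
have Ay : A y by near: y.
have yt : `|t - y| < a / K.
  by near: y; apply: cvgr_dist_lt; [exact: cvg_id|rewrite divr_gt0].
have MK : M < K.
  by rewrite (le_lt_trans (_ : M <= Num.max 0 M)) ?ltrDl// le_max lexx orbT.
have := HM _ MK (t, y) (conj (nbhs_singleton At) Ay) => /=.
by move=> /le_lt_trans; apply; rewrite mulrC -ltr_pdivlMr.
Unshelve. all: by end_near. Qed.

Theorem theorem1p2 (R : realType) (n : nat) (alpha s omega r q : R)
    (F : R -> R) (c0 gamma tau : R) (u v : 'rV[R]_n -> R)
    (n_ge1 : (1 <= n)%N)
    (alpha_gt0 : 0 < alpha) (alpha_lt2 : alpha < 2)
    (s_gt0 : 0 < s) (s_lt1 : s < 1)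
    (omega_ge0 : 0 <= omega) (r_gt1 : 1 < r) (q_gt1 : 1 < q)
    (F_lip : locally_lipschitz F) (F0 : F 0 = 0) (c0_gt0 : 0 < c0)
    (F'_ge : {ae lebesgue_measure, forall t : R,
                derivable F t 1 /\ c0 <= (F^`())%classic t})
    (u_C11 : C11loc u) (u_L : Lalpha F alpha u)
    (v_C11 : C11loc v) (v_L : L2s s v)
    (uv_sol : positive_solution F alpha s omega r q u v)
    (gamma_gt0 : 0 < gamma) (tau_gt0 : 0 < tau)
    (u_decay : decays_like u gamma) (v_decay : decays_like v tau)
    (alpha_lt : alpha < Num.min (gamma * (r - 1) + tau) (r * gamma))
    (s_lt : 2 * s < gamma * (q - 1)) :
  exists x0 : 'rV[R]_n, radially_decreasing u x0 /\ radially_decreasing v x0.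
Proof.
have u_cont : continuous u.
  by move=> x; have [du _ _] := u_C11; exact: differentiable_continuous.
have v_cont : continuous v.
  by move=> x; have [dv _ _] := v_C11; exact: differentiable_continuous.
have F_cont := locally_lipschitz_continuous F_lip.
have F_mono := locally_lipschitz_derivative_ge F_lip F'_ge.
have [exp1 exp2] : alpha < gamma * (r - 1) + tau /\ alpha < r * gamma.
  by move: alpha_lt; rewrite lt_min => /andP.
have dich := dominated_dichotomy n_ge1 alpha_gt0 alpha_lt2 s_gt0 s_lt1 q_gt1
  c0_gt0 F_mono F_cont u_cont v_cont uv_sol.
apply: (@radially_decreasing_exists R n u v) => //.
- by move=> x; have [] := uv_sol x.
- exact: decays_like_vanishing u_decay.
- move=> L; apply: (dominated_of_region n_ge1 alpha_gt0 alpha_lt2 s_gt0 s_lt1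
    omega_ge0 r_gt1 q_gt1 c0_gt0 F_mono F_cont u_cont v_cont uv_sol gamma_gt0
    tau_gt0 u_decay v_decay exp1 exp2 s_lt).
Qed.
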